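(* Let $\delta,\epsilon$ be constants with $0\le\delta<1$, $0<\epsilon\le\frac12$ and $\delta>2\epsilon$. Then $\mathsf{BP}_{\epsilon}\mathsf{CL}_{\delta}\mathsf{P}=\mathsf{BPP}$.
   Context: A catalytic Turing machine has a read-only input tape, a write-only output tape, a read-write work tape and a read-write catalytic tape which initially holds an arbitrary string $\tau$. A randomized such machine with $c$ catalytic bits additionally has read-only, read-once access to a uniformly random string $r\in\{0,1\}^{2^c}$. For functions $s,c$ of the input length $n$, a language $L$ is in $\mathsf{BP}_{\epsilon}\mathsf{CSPACE}_{\delta}[s,c]$ (for $0\le\delta<1$, $0<\epsilon\le\frac12$) if there is a randomized catalytic machine $M$ with $s$ bits of work space and $c$ bits of catalytic space such that for every input $x\in\{0,1\}^n$ and every initial catalytic content $\tau\in\{0,1\}^c$: $M$ always halts, outputs $L(x)$ with probability at least $\frac12+\epsilon$ over $r$, and halts with exactly $\tau$ on its catalytic tape with probability at least $1-\delta$ over $r$. $\mathsf{BP}_{\epsilon}\mathsf{CL}_{\delta}\mathsf{P}$ is the class of languages decided in this sense by such machines with $s=k\log n$, $c=n^k$ for some constant $k$, which additionally always halt within $n^k$ steps (on every input, initial tape and random string). *)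

(* Defs.v *)
From mathcomp Require Import all_boot all_order all_algebra.
From mathcomp Require Import reals.
Unset Printing Implicit Defensive.
Import Order.TTheory GRing.Theory Num.Theory.

(* Randomized multi-tape machines over the binary alphabet.                  *)
(*  - read-only input tape holding x with end-markers: head position         *)
(*    p in [0, |x|+1], reading [None] at 0 and |x|+1, Some x_(p-1) otherwise; *)
(*  - read-write work tape of a fixed number of bits (initially all 0);      *)
(*  - read-write catalytic tape of a fixed number of bits (initially tau);   *)
(*  - read-only, read-once (one-way) random tape r: in a state/symbol         *)
(*    configuration where [coin] is true, the machine consumes the next      *)
(*    random bit (and its transition may depend on it); otherwise the        *)
(*    transition gets [None] and the random head does not move.              *)
(*  - the (one-bit) output is given by the halting state: [halt q = Some b]  *)
(*    means the machine halted having output b.                              *)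
(* Heads never leave their tapes (moves are clamped).                        *)

Inductive move := MoveL | MoveS | MoveR.

Record TM := {
  tm_state : finType;
  tm_start : tm_state;
  tm_halt : tm_state -> option bool;
  tm_coin : tm_state -> option bool -> bool -> bool -> bool;
  tm_delta : tm_state -> option bool -> bool -> bool -> option bool ->
             tm_state * move * (bool * move) * (bool * move)
}.

Arguments tm_start : clear implicits.
Arguments tm_halt : clear implicits.
Arguments tm_coin : clear implicits.
Arguments tm_delta : clear implicits.

Record config (Q : Type) := Config {
  c_st : Q; c_ip : nat; c_wt : seq bool; c_wp : nat;
  c_ct : seq bool; c_cp : nat; c_rp : nat }.
Arguments c_st {Q}. Arguments c_ip {Q}. Arguments c_wt {Q}. Arguments c_wp {Q}.
Arguments c_ct {Q}. Arguments c_cp {Q}. Arguments c_rp {Q}.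

Definition mv (m : move) (p hi : nat) : nat :=
  match m with MoveL => p.-1 | MoveS => p | MoveR => minn p.+1 hi end.

Definition write_cell (t : seq bool) (p : nat) (b : bool) : seq bool :=
  if p < size t then set_nth false t p b else t.

Definition step (M : TM) (x r : seq bool) (c : config (tm_state M))
  : config (tm_state M) :=
  let q := c_st c in
  if tm_halt M q is Some _ then c else
  let i := if (0 < c_ip c) && (c_ip c <= size x)
           then Some (nth false x (c_ip c).-1) else None in
  let w := nth false (c_wt c) (c_wp c) in
  let cb := nth false (c_ct c) (c_cp c) in
  let flip := tm_coin M q i w cb in
  let b := if flip then Some (nth false r (c_rp c)) else None in
  match tm_delta M q i w cb b with
  | (q', mi, (wb, mw), (cbw, mc)) =>
    {| c_st := q';
       c_ip := mv mi (c_ip c) (size x).+1;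
       c_wt := write_cell (c_wt c) (c_wp c) wb;
       c_wp := mv mw (c_wp c) (size (c_wt c)).-1;
       c_ct := write_cell (c_ct c) (c_cp c) cbw;
       c_cp := mv mc (c_cp c) (size (c_ct c)).-1;
       c_rp := c_rp c + flip |}
  end.

Definition init (M : TM) (s : nat) (tau : seq bool) : config (tm_state M) :=
  {| c_st := tm_start M; c_ip := 0; c_wt := nseq s false; c_wp := 0;
     c_ct := tau; c_cp := 0; c_rp := 0 |}.

Definition run (M : TM) (x : seq bool) (s : nat) (tau r : seq bool) (t : nat)
  : config (tm_state M) := iter t (step M x r) (init M s tau).

Definition prob {R : realType} {m : nat} (P : m.-tuple bool -> bool) : R :=
  (#|[set r : m.-tuple bool | P r]|%:R / (2 ^ m)%:R)%R.

Definition language := seq bool -> bool.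

(* polynomial time bound n^k (+k, so that it is also meaningful at n = 0) *)
Definition tbound (k n : nat) : nat := n ^ k + k.

Definition BPCLP {R : realType} (delta eps : R) (L : language) : Prop :=
  exists (k : nat) (M : TM), forall (x tau : seq bool),
    let n := size x in
    let s := k * up_log 2 n in
    let c := n ^ k in
    let T := tbound k n in
    size tau = c ->
    (forall r : (2 ^ c).-tuple bool,
        tm_halt M (c_st (run M x s tau r T)) != None) /\
    (1 / 2 + eps <= prob (fun r : (2 ^ c).-tuple bool =>
        tm_halt M (c_st (run M x s tau r T)) == Some (L x)))%R /\
    (1 - delta <= prob (fun r : (2 ^ c).-tuple bool =>
        c_ct (run M x s tau r T) == tau))%R.

(* BPP: randomized polynomial-time machines (work tape as long as the time
   bound, no catalytic tape), error probability at most 1/3. *)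
Definition BPP {R : realType} (L : language) : Prop :=
  exists (k : nat) (M : TM), forall x : seq bool,
    let T := tbound k (size x) in
    (forall r : T.-tuple bool,
        tm_halt M (c_st (run M x T [::] r T)) != None) /\
    ((2 / 3 : R) <= prob (fun r : T.-tuple bool =>
        tm_halt M (c_st (run M x T [::] r T)) == Some (L x)))%R.

(* Main.v *)
Require Import Defs.
From mathcomp Require Import all_boot all_order all_algebra.
From mathcomp Require Import reals.
From HB Require Import structures.
From mathcomp Require Import zify ring lra boolp.
Import Order.TTheory GRing.Theory Num.Theory.
Set Implicit Arguments.
Unset Strict Implicit.

(** From BPCLP to BPP: run the machine repeatedly on an all-zero catalytic tape
and take a majority vote.  From BPP to BPCLP: choose a dyadic [q] with
[2 eps < q <= delta]; with probability [q] sacrifice the catalytic tape and use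
it as the work tape of an amplified BPP computation of error [eta], and with
probability [1 - q] leave the tape alone and output a fair coin.  The answer is
correct with probability at least [1/2 + q (1/2 - eta) >= 1/2 + eps], and the
tape is restored with probability at least [1 - q >= 1 - delta].

One program serves both directions: it lives on a single tape, the work tape or
the catalytic tape, with arbitrary initial contents.  It keeps many binary tapes
as tracks of that tape, in blocks carrying head marks and a frontier flag; a
block is cleared when the frontier first reaches it, so that the initial contents
do not matter.  Each trial uses fresh tracks, on which it first marks the lengths
[k * up_log 2 n] and [n ^ k] of the simulated tapes in unary.  Inputs of length
at most 1, where these lengths degenerate, are answered from a table. *)

(** * Structured programs and their compilation to machines *)

(** Both inclusions meet in [accepts_with]: on inputs of length at least 2, a machine with
    [k * up_log 2 n] work cells and an all-zero catalytic tape of [n ^ k] cells is right with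
    probability at least [p0], where [p0 > 1 / 2]. A catalytic machine has this form already; a BPP
    machine gets it by moving its long work tape to the catalytic one. The gap between [2 * eps] and
    [delta] is what amplification lives on. Sacrificing the tape lifts the chance of success from
    1/2 to almost 1, so doing it with probability [q] gains almost [q / 2], which must reach [eps],
    while [q] may not exceed [delta]. The error still allowed is then a positive constant, so a
    constant number of trials suffices, and their tracks fit into blocks of constant width. Trials
    consume varying numbers of random bits, so they are not independent by virtue of fixed disjoint
    portions of the random string. Independence comes from an expectation over the computation tree:
    since the random tape is one-way, the bits unread after a trial are still uniform. The error of
    the vote is then bounded by an exponential moment, one trial at a time. *)

Section Commands.
Variables A F : Type.

Inductive cmd :=
| Atom of A
| Seq of cmd & cmd
| Ite of (F -> bool) & cmd & cmd
| While of (F -> bool) & cmd.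

Fixpoint line (a : A) (l : seq A) : cmd :=
  if l is a' :: l' then Seq (Atom a) (line a' l') else Atom a.

Variables (S : Type) (mem : S -> F) (sem : A -> S -> S).

Inductive exec : cmd -> S -> nat -> S -> Prop :=
| ExAtom a s : exec (Atom a) s 1 (sem a s)
| ExSeq c1 c2 s n s1 m s2 :
    exec c1 s n s1 -> exec c2 s1 m s2 -> exec (Seq c1 c2) s (n + m) s2
| ExIteT (b : F -> bool) c1 c2 s n s1 :
    b (mem s) -> exec c1 s n s1 -> exec (Ite b c1 c2) s n.+1 s1
| ExIteF (b : F -> bool) c1 c2 s n s1 :
    ~~ b (mem s) -> exec c2 s n s1 -> exec (Ite b c1 c2) s n.+1 s1
| ExWhileT (b : F -> bool) c s n s1 m s2 :
    b (mem s) -> exec c s n s1 -> exec (While b c) s1 m s2 ->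
    exec (While b c) s (n + m).+1 s2
| ExWhileF (b : F -> bool) c s : ~~ b (mem s) -> exec (While b c) s 1 s.

(** An upper bound on the time is enough: a halted machine stays in its configuration, so spare
    steps do no harm. *)
Definition runs c s t s' := exists2 n, n <= t & exec c s n s'.

Lemma runs_weaken c s t t' s' : runs c s t s' -> t <= t' -> runs c s t' s'.
Proof. by move=> [n le_n ex] le_t; exists n => //; apply: leq_trans le_t. Qed.

Lemma runs_atom a s : runs (Atom a) s 1 (sem a s).
Proof. by exists 1 => //; constructor. Qed.

Lemma runs_seq c1 c2 s n s1 m s2 :
  runs c1 s n s1 -> runs c2 s1 m s2 -> runs (Seq c1 c2) s (n + m) s2.
Proof.
move=> [n' le1 ex1] [m' le2 ex2]; exists (n' + m'); first exact: leq_add.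
exact: ExSeq ex1 ex2.
Qed.

Lemma runs_iteT (b : F -> bool) c1 c2 s n s1 :
  b (mem s) -> runs c1 s n s1 -> runs (Ite b c1 c2) s n.+1 s1.
Proof. by move=> bT [n' le1 ex1]; exists n'.+1 => //; constructor. Qed.

Lemma runs_iteF (b : F -> bool) c1 c2 s n s1 :
  ~~ b (mem s) -> runs c2 s n s1 -> runs (Ite b c1 c2) s n.+1 s1.
Proof. by move=> bF [n' le1 ex1]; exists n'.+1 => //; apply: ExIteF. Qed.

Lemma runs_whileT (b : F -> bool) c s n s1 m s2 :
  b (mem s) -> runs c s n s1 -> runs (While b c) s1 m s2 ->
  runs (While b c) s (n + m).+1 s2.
Proof.
move=> bT [n' le1 ex1] [m' le2 ex2]; exists (n' + m').+1; first by rewrite ltnS leq_add.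
exact: ExWhileT ex1 ex2.
Qed.

Lemma runs_whileF (b : F -> bool) c s :
  ~~ b (mem s) -> runs (While b c) s 1 s.
Proof. by move=> bF; exists 1 => //; constructor. Qed.

(** The index of [I] counts the iterations still to come, so one invariant yields termination,
    running time and final state together. *)
Lemma runs_while (I : nat -> S -> Prop) (b : F -> bool) c t :
  (forall d s, I d.+1 s -> b (mem s) /\ exists2 s', runs c s t s' & I d s') ->
  (forall s, I 0 s -> ~~ b (mem s)) ->
  forall d s, I d s -> exists2 s', runs (While b c) s (d * t.+1).+1 s' & I 0 s'.
Proof.
move=> IS I0; elim=> [|d IH] s Is.
  by exists s => //; rewrite mul0n; apply/runs_whileF/I0.
have [bT [s1 r1 I1]] := IS _ _ Is; have [s2 r2 I2] := IH _ I1.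
exists s2 => //; apply: runs_weaken (runs_whileT bT r1 r2) _.
by rewrite mulSn addnS addSn.
Qed.

Lemma runs_line a l s :
  runs (line a l) s (size l).+1 (foldl (fun s a => sem a s) s (a :: l)).
Proof.
elim: l a s => [|a' l IH] a s; first exact: runs_atom.
exact: (runs_seq (runs_atom a s) (IH a' _)).
Qed.

End Commands.
Arguments Atom {A F}.
Arguments line {A F}.
Arguments exec {A F S}.
Arguments runs {A F S}.

Definition input_symbol (x : seq bool) (p : nat) : option bool :=
  if (0 < p) && (p <= size x) then Some (nth false x p.-1) else None.

Lemma write_cell_id t p : write_cell t p (nth false t p) = t.
Proof.
rewrite /write_cell; case: ltnP => // lt_p.
apply: (@eq_from_nth _ false) => [|i _]; first by rewrite size_set_nth (maxn_idPr lt_p).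
by rewrite nth_set_nth /=; case: eqP => [->|].
Qed.

Lemma size_write_cell t p b : size (write_cell t p b) = size t.
Proof.
by rewrite /write_cell; case: ltnP => // lt_p; rewrite size_set_nth (maxn_idPr lt_p).
Qed.

Lemma nth_write_cell t p b i : p < size t ->
  nth false (write_cell t p b) i = if i == p then b else nth false t i.
Proof. by rewrite /write_cell => ->; rewrite nth_set_nth. Qed.

(** * Atomic actions of one-tape programs *)

Section OneTape.
Variable F : Type.

Record atom := Act {
  a_coin : F -> bool;
  a_act : F -> option bool -> bool -> option bool -> F * move * (bool * move) }.

Record tstate := TState {
  t_mem : F; t_ip : nat; t_tape : seq bool; t_pos : nat; t_rp : nat }.

Definition tsem (x r : seq bool) (a : atom) (s : tstate) : tstate :=
  let flip := a_coin a (t_mem s) in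
  let b := if flip then Some (nth false r (t_rp s)) else None in
  let: (f, mi, (wb, m)) :=
    a_act a (t_mem s) (input_symbol x (t_ip s)) (nth false (t_tape s) (t_pos s)) b in
  TState f (mv mi (t_ip s) (size x).+1) (write_cell (t_tape s) (t_pos s) wb)
    (mv m (t_pos s) (size (t_tape s)).-1) (t_rp s + flip).

Definition noop : atom :=
  Act (fun _ => false) (fun f _ w _ => (f, MoveS, (w, MoveS))).

Lemma sem_noop x r s : tsem x r noop s = s.
Proof. by case: s => f ip t p rp; rewrite /tsem /= write_cell_id addn0. Qed.

End OneTape.
Arguments noop {F}.
Arguments tsem {F}.

(** * Control positions as machine states *)

Section Compile.
Variable F : finType.
Notation prog := (cmd (atom F) F).

Fixpoint pos (c : prog) : finType :=
  match c with
  | Atom _ => unit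
  | Seq c1 c2 => (pos c1 + pos c2)%type
  | Ite _ c1 c2 => option (pos c1 + pos c2)
  | While _ c1 => option (pos c1)
  end.

Fixpoint entry (c : prog) : pos c :=
  match c with
  | Atom _ => tt
  | Seq c1 c2 => inl (entry c1)
  | Ite _ _ _ => None
  | While _ _ => None
  end.

Fixpoint action (c : prog) : pos c -> atom F :=
  match c with
  | Atom a => fun _ => a
  | Seq c1 c2 => fun p => match p with inl p => action p | inr p => action p end
  | Ite _ c1 c2 => fun p =>
    match p with None => noop | Some (inl p) => action p | Some (inr p) => action p end
  | While _ c1 => fun p => if p is Some p then action p else noop
  end.

(** The successor is chosen from the memory left by the action. A test is a position of its own,
    which executes [noop] and then branches. For [While] the test is the position [None], so
    [Some (goto p f)] sends the exit of the body straight back to it. *)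
Fixpoint goto (c : prog) : pos c -> F -> option (pos c) :=
  match c return pos c -> F -> option (pos c) with
  | Atom a => fun _ _ => None
  | Seq c1 c2 => fun p f =>
    match p with
    | inl p => Some (if goto p f is Some p' then inl p' else inr (entry c2))
    | inr p => omap inr (goto p f)
    end
  | Ite b c1 c2 => fun p f =>
    match p with
    | None => Some (Some (if b f then inl (entry c1) else inr (entry c2)))
    | Some (inl p) => omap (fun p => Some (inl p)) (goto p f)
    | Some (inr p) => omap (fun p => Some (inr p)) (goto p f)
    end
  | While b c1 => fun p f =>
    match p with
    | None => if b f then Some (Some (entry c1)) else None
    | Some p => Some (goto p f)
    end
  end.

Variables x r : seq bool.
Notation sem := (tsem x r).
Notation exec := (exec (@t_mem F) sem).

Inductive reach (c : prog) : pos c -> tstate F -> nat -> tstate F -> Prop :=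
| ReachExit p s : goto p (t_mem (sem (action p) s)) = None ->
    reach p s 1 (sem (action p) s)
| ReachStep p s p' n s' : goto p (t_mem (sem (action p) s)) = Some p' ->
    reach p' (sem (action p) s) n s' -> reach p s n.+1 s'.

Lemma reach_seqr c1 c2 p s n s1 :
  @reach c2 p s n s1 -> @reach (Seq c1 c2) (inr p) s n s1.
Proof.
elim=> {p s n s1} [p s e|p s p' n s1 e _ IH].
  by apply: (@ReachExit (Seq c1 c2)); rewrite /= e.
apply: (@ReachStep (Seq c1 c2) _ _ (inr p')); last exact: IH.
  by rewrite /= e.
Qed.

Lemma reach_seq c1 c2 p s n s1 m s2 :
  @reach c1 p s n s1 -> @reach c2 (entry c2) s1 m s2 ->
  @reach (Seq c1 c2) (inl p) s (n + m) s2.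
Proof.
elim=> {p s n s1} [p s e|p s p' n s1 e _ IH] R2.
  apply: (@ReachStep (Seq c1 c2) _ _ (inr (entry c2))); last exact: reach_seqr.
  by rewrite /= e.
rewrite addSn; apply: (@ReachStep (Seq c1 c2) _ _ (inl p')); last exact: IH.
by rewrite /= e.
Qed.

Lemma reach_itel b c1 c2 p s n s1 :
  @reach c1 p s n s1 -> @reach (Ite b c1 c2) (Some (inl p)) s n s1.
Proof.
elim=> {p s n s1} [p s e|p s p' n s1 e _ IH].
  by apply: (@ReachExit (Ite b c1 c2)); rewrite /= e.
apply: (@ReachStep (Ite b c1 c2) _ _ (Some (inl p'))); last exact: IH.
  by rewrite /= e.
Qed.

Lemma reach_iter b c1 c2 p s n s1 :
  @reach c2 p s n s1 -> @reach (Ite b c1 c2) (Some (inr p)) s n s1.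
Proof.
elim=> {p s n s1} [p s e|p s p' n s1 e _ IH].
  by apply: (@ReachExit (Ite b c1 c2)); rewrite /= e.
apply: (@ReachStep (Ite b c1 c2) _ _ (Some (inr p'))); last exact: IH.
  by rewrite /= e.
Qed.

Lemma reach_while b c p s n s1 m s2 :
  @reach c p s n s1 -> @reach (While b c) None s1 m s2 ->
  @reach (While b c) (Some p) s (n + m) s2.
Proof.
elim=> {p s n s1} [p s e|p s p' n s1 e _ IH] R2.
  apply: (@ReachStep (While b c) _ _ None); last exact: R2.
  by rewrite /= e.
rewrite addSn; apply: (@ReachStep (While b c) _ _ (Some p')); last exact: IH.
by rewrite /= e.
Qed.

(** Big steps become small steps with the same count, because [exec] charges one step per test and a
    compiled test is one [noop]. *)
Lemma exec_reach c s n s' : exec c s n s' -> reach (entry c) s n s'.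
Proof.
elim=> {c s n s'} [a s|c1 c2 s n s1 m s2 _ R1 _ R2|b c1 c2 s n s1 bT _ R
  |b c1 c2 s n s1 bF _ R|b c s n s1 m s2 bT _ R1 _ R2|b c s bF].
- exact: ReachExit.
- exact: reach_seq R1 R2.
- apply: (@ReachStep (Ite b c1 c2) None _ (Some (inl (entry c1)))); rewrite sem_noop.
    by rewrite /= bT.
  exact: reach_itel.
- apply: (@ReachStep (Ite b c1 c2) None _ (Some (inr (entry c2)))); rewrite sem_noop.
    by rewrite /= (negbTE bF).
  exact: reach_iter.
- apply: (@ReachStep (While b c) None _ (Some (entry c))); rewrite sem_noop.
    by rewrite /= bT.
  exact: reach_while R1 R2.
- rewrite -{2}(sem_noop x r s); apply: (@ReachExit (While b c) None).
  by rewrite sem_noop /= (negbTE bF).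
Qed.

(* [side] tells whether the program lives on the work tape (true) or on the
   catalytic tape (false); the other tape is never modified. *)
Definition compile (side : bool) (c : prog) (f0 : F) (out : F -> bool) : TM :=
  {| tm_state := (option (pos c) * F)%type;
     tm_start := (Some (entry c), f0);
     tm_halt := fun q => if q.1 is None then Some (out q.2) else None;
     tm_coin := fun q _ _ _ => if q.1 is Some p then a_coin (action p) q.2 else false;
     tm_delta := fun q i w cb b =>
       if q.1 is Some p then
         let: (f, mi, (wb, m)) := a_act (action p) q.2 i (if side then w else cb) b in
         ((goto p f, f), mi, (if side then wb else w, if side then m else MoveS),
          (if side then cb else wb, if side then MoveS else m))
       else (q, MoveS, (w, MoveS), (cb, MoveS)) |}.

Definition embed side c f0 out (other : seq bool) (p : option (pos c)) (s : tstate F) :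
  config (tm_state (compile side c f0 out)) :=
  let o := t_tape s in
  let q : tm_state (compile side c f0 out) := (p, t_mem s) in
  if side then Config _ q (t_ip s) o (t_pos s) other 0 (t_rp s)
  else Config _ q (t_ip s) other 0 o (t_pos s) (t_rp s).

Lemma step_embed side c f0 out other p s :
  step (compile side c f0 out) x r (embed side f0 out other (Some p) s) =
  embed side f0 out other (goto p (t_mem (sem (action p) s))) (sem (action p) s).
Proof.
case: s => f ip t po rp; rewrite /step /embed /tsem /=.
by case: side => /=; rewrite -/(input_symbol x ip);
  case: (a_act _ _ _ _ _) => [[f' mi] [wb m]] /=; rewrite write_cell_id.
Qed.

Lemma step_embed_halt side c f0 out other s t :
  iter t (step (compile side c f0 out) x r) (embed side f0 out other None s) =
  embed side f0 out other None s.
Proof. by elim: t => //= t ->; case: side. Qed.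

Lemma iter_embed side c f0 out other p s n s' : @reach c p s n s' ->
  iter n (step (compile side c f0 out) x r) (embed side f0 out other (Some p) s) =
  embed side f0 out other None s'.
Proof.
elim=> {p s n s'} [p s e|p s p' n s' e _ IH].
  by rewrite /= step_embed e.
by rewrite iterSr step_embed e.
Qed.

Lemma run_compile_work c f0 out s tau s' T :
  runs (@t_mem F) sem c (TState f0 0 (nseq s false) 0 0) T s' ->
  run (compile true c f0 out) x s tau r T = embed true f0 out tau None s'.
Proof.
move=> [n le_n /exec_reach R]; rewrite -(subnK le_n) /run iterD.
rewrite (_ : init _ _ _ =
  embed true f0 out tau (Some (entry c)) (TState f0 0 (nseq s false) 0 0)) //.
by rewrite (iter_embed true f0 out tau R) step_embed_halt.
Qed.

Lemma run_compile_cat c f0 out s tau s' T :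
  runs (@t_mem F) sem c (TState f0 0 tau 0 0) T s' ->
  run (compile false c f0 out) x s tau r T = embed false f0 out (nseq s false) None s'.
Proof.
move=> [n le_n /exec_reach R]; rewrite -(subnK le_n) /run iterD.
rewrite (_ : init _ _ _ =
  embed false f0 out (nseq s false) (Some (entry c)) (TState f0 0 tau 0 0)) //.
by rewrite (iter_embed false f0 out _ R) step_embed_halt.
Qed.

End Compile.

(** * Multi-tape programs on a single tape *)

(** The control remembers pending moves, so [move] has to be a [finType]. *)
Definition move_code (m : move) : option bool :=
  match m with MoveL => Some false | MoveS => None | MoveR => Some true end.
Definition move_decode (c : option bool) : move :=
  match c with Some false => MoveL | None => MoveS | Some true => MoveR end.
Lemma move_codeK : cancel move_code move_decode. Proof. by case. Qed.
HB.instance Definition _ := Finite.copy move (can_type move_codeK).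

Section MultiTape.
Variable G : Type.

Definition upd (T : Type) (f : nat -> T) (i : nat) (v : T) : nat -> T :=
  fun j => if j == i then v else f j.

(* A head move [None] sends the head back to cell 0. *)
Record hatom := HAct {
  h_tape : nat;
  h_coin : G -> bool;
  h_act : G -> option bool -> bool -> option bool ->
          G * move * (bool * option move) }.

Record hstate := HState {
  hg : G; hip : nat; htp : nat -> nat -> bool; hhd : nat -> nat; hrp : nat }.

Definition hmv (m : option move) (p : nat) : nat :=
  match m with
  | None => 0 | Some MoveL => p.-1 | Some MoveS => p | Some MoveR => p.+1
  end.

Definition hsem (x r : seq bool) (a : hatom) (h : hstate) : hstate :=
  let j := h_tape a in
  let flip := h_coin a (hg h) in
  let b := if flip then Some (nth false r (hrp h)) else None in
  let: (g, mi, (wb, m)) :=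
    h_act a (hg h) (input_symbol x (hip h)) (htp h j (hhd h j)) b in
  HState g (mv mi (hip h) (size x).+1)
    (upd (htp h) j (upd (htp h j) (hhd h j) wb))
    (upd (hhd h) j (hmv m (hhd h j))) (hrp h + flip).

End MultiTape.

(** * Tracks stored in blocks of constant width *)

Section Blocks.
Variable J : nat.
Definition width := 2 + 2 * J.
Notation K := width.

(* Tape [j] occupies offsets [2 + 2 j] (head mark) and [3 + 2 j] (symbol) of every
   block; offset 0 flags the leftmost block and offset 1 the last block in use. *)
Definition block_bit (top : nat) (mk tp : nat -> nat -> bool) (i o : nat) : bool :=
  if o == 0 then i == 0 else if o == 1 then i == top
  else if odd o then tp (o - 2)./2 i else mk (o - 2)./2 i.

(** Nothing is said about the cells beyond block [top]: they still hold the arbitrary initial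
    contents. *)
Definition layout top (t : seq bool) mk tp :=
  forall i o, i <= top -> o < K -> nth false t (K * i + o) = block_bit top mk tp i o.

Lemma eq_block i o i' o' : o < K -> o' < K ->
  (K * i + o == K * i' + o') = (i == i') && (o == o').
Proof.
move=> lo lo'; apply/eqP/andP => [e|[/eqP -> /eqP ->] //].
have K0 : 0 < K by [].
have ei : i = i'.
  have := congr1 (divn^~ K) e.
  by rewrite /= ![K * _]mulnC !divnMDl // !divn_small // !addn0.
by rewrite ei eqxx; move: e; rewrite ei => /addnI ->.
Qed.

Lemma layout_mark top t mk tp i j b :
  i <= top -> j < J -> K * top.+1 <= size t -> layout top t mk tp ->
  layout top (write_cell t (K * i + (2 + 2 * j)) b) (upd mk j (upd (mk j) i b)) tp.
Proof.
move=> li lj lt lay i' o' li' lo'.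
have lo : 2 + 2 * j < K by rewrite /width; lia.
have lp : K * i + (2 + 2 * j) < size t.
  by apply: leq_trans lt; rewrite mulnS; have : K * i <= K * top; [rewrite leq_mul2l li orbT|lia].
rewrite nth_write_cell // eq_block // lay // /block_bit /upd.
case: (i' =P i) => [->|ne_i] /=; last first.
  by do 3 (case: ifP => [//|_]); case: eqP => // ->; case: eqP.
case: (o' =P 2 + 2 * j) => [->|ne] /=.
  have -> : (2 + 2 * j - 2)./2 = j by lia.
  by rewrite !eqxx oddD oddM.
do 3 case: ifP => //; move=> o_even o1 o0.
by case: eqP => // e; case: ne; move: o_even o1 o0 e; lia.
Qed.

Lemma layout_sym top t mk tp i j b :
  i <= top -> j < J -> K * top.+1 <= size t -> layout top t mk tp ->
  layout top (write_cell t (K * i + (3 + 2 * j)) b) mk (upd tp j (upd (tp j) i b)).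
Proof.
move=> li lj lt lay i' o' li' lo'.
have lo : 3 + 2 * j < K by rewrite /width; lia.
have lp : K * i + (3 + 2 * j) < size t.
  by apply: leq_trans lt; rewrite mulnS; have : K * i <= K * top; [rewrite leq_mul2l li orbT|lia].
rewrite nth_write_cell // eq_block // lay // /block_bit /upd.
case: (i' =P i) => [->|ne_i] /=; last first.
  by do 2 (case: ifP => [//|_]); case: ifP => [_|//]; case: eqP => // ->; case: eqP.
case: (o' =P 3 + 2 * j) => [->|ne] /=.
  have -> : uphalf (0 + 2 * j) = j by lia.
  by rewrite !eqxx oddD oddM.
do 3 case: ifP => //; move=> o_odd o1 o0.
by case: eqP => // e; case: ne; move: o_odd o1 o0 e; lia.
Qed.

Fixpoint overwrite (t : seq bool) (p : nat) (bs : seq bool) : seq bool :=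
  if bs is b :: bs' then overwrite (write_cell t p b) p.+1 bs' else t.

Lemma size_overwrite t p bs : size (overwrite t p bs) = size t.
Proof. by elim: bs t p => //= b bs IH t p; rewrite IH size_write_cell. Qed.

Lemma nth_overwrite t p bs i : p + size bs <= size t ->
  nth false (overwrite t p bs) i =
  if (p <= i) && (i < p + size bs) then nth false bs (i - p) else nth false t i.
Proof.
elim: bs t p => [|b bs IH] t p /= le_t.
  by rewrite addn0; case: ltngtP.
rewrite IH ?size_write_cell ?addSnnS // nth_write_cell; last by lia.
case: (ltngtP p i) => [lt_p|lt_p|->] /=.
- by case: ifP => // _; rewrite (_ : i - p = (i - p.+1).+1) //; lia.
- by [].
- by rewrite subnn ifT //; lia.
Qed.

(** The second bit is always [true], since a block is blanked exactly when it becomes the last one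
    in use. *)
Definition blank_block (fst : bool) (mark : bool) : seq bool :=
  [:: fst, true & flatten (nseq J [:: mark; false])].

Lemma size_blank_block f m : size (blank_block f m) = K.
Proof.
rewrite /= /width size_flatten /shape map_nseq sumn_nseq /=; lia.
Qed.

Lemma nth_blank_block f m o : o < K ->
  nth false (blank_block f m) o =
  if o == 0 then f else if o == 1 then true else if odd o then false else m.
Proof.
case: o => [|[|o]] //=; rewrite /width !ltnS => lo.
have {lo} : o < 2 * J by lia.
rewrite negbK; elim: J o => [|n IH] [|[|o]] //= lo.
by rewrite IH ?negbK //; lia.
Qed.

(** The abstract tapes carry neither a mark nor a 1 in block [top.+1], so overwriting whatever is
    physically there by a blank block makes the two agree; only the frontier flag has to move. *)
Lemma layout_extend top t mk tp :
  K * top.+2 <= size t -> layout top t mk tp ->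
  (forall j, j < J -> mk j top.+1 = false /\ tp j top.+1 = false) ->
  layout top.+1
    (overwrite (write_cell t (K * top + 1) false) (K * top.+1) (blank_block false false)) mk tp.
Proof.
move=> lt lay blank i o li lo.
have K1 : 1 < K by [].
rewrite nth_overwrite ?size_write_cell ?size_blank_block; last by rewrite addnC -mulnS.
rewrite nth_write_cell ?eq_block //; last by move: lt K1; rewrite 2!mulnS; lia.
move: li; rewrite leq_eqVlt => /orP[/eqP ->|].
  rewrite leq_addr ltn_add2l lo /= addKn nth_blank_block // /block_bit.
  case: o lo => [|[|o]] lo //; rewrite ?eqxx //= negbK subn2 /=.
  have [|b1 b2] := blank o./2; first by move: lo; rewrite /width; lia.
  by rewrite b1 b2; case: (odd o).
rewrite ltnS => li; rewrite [_ <= K * i + o]leqNgt (_ : K * i + o < K * top.+1); last first.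
  apply: (@leq_trans (K * i.+1)); first by rewrite mulnS addnC ltn_add2r.
  by rewrite leq_mul2l ltnS li orbT.
rewrite /= lay // /block_bit; case: o lo => [|[|o]] lo //=; first by rewrite andbF.
  rewrite andbT; case: eqP => [->|//]; rewrite ?(ltn_eqF (ltnSn _)) //.
  by rewrite (ltn_eqF (leq_ltn_trans li (ltnSn _))).
by rewrite andbF.
Qed.

Lemma layout_init t mk tp : K <= size t ->
  (forall j, j < J -> mk j 0 = true /\ tp j 0 = false) ->
  layout 0 (overwrite t 0 (blank_block true true)) mk tp.
Proof.
move=> lt blank i o; rewrite leqn0 => /eqP -> lo.
rewrite muln0 nth_overwrite size_blank_block // add0n lo subn0 nth_blank_block // /block_bit.
case: o lo => [|[|o]] lo //=; rewrite negbK subn2 /=.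
have [|b1 b2] := blank o./2; first by move: lo; rewrite /width; lia.
by rewrite b1 b2; case: (odd o).
Qed.

End Blocks.

(** * Lowering multi-tape programs to one tape *)

Section Lowering.
Variables (G : Type) (J : nat).
(** The control consists of the memory of the multi-tape program, a scratch bit filled by [rd], and
    the head move requested by the current atom. *)
Notation F := (G * bool * option move)%type.
Notation K := (width J).
Notation prog := (cmd (atom F) F).

Definition no_coin (f : F) := false.
Definition go (m : move) : atom F := Act no_coin (fun f _ w _ => (f, MoveS, (w, m))).
Definition wr (b : bool) (m : move) : atom F :=
  Act no_coin (fun f _ w _ => (f, MoveS, (b, m))).
Definition rd : atom F :=
  Act no_coin (fun f _ w _ => ((f.1.1, w, f.2), MoveS, (w, MoveS))).

(** The leading [noop] admits the empty list; it costs the extra step in [runs_straight]. *)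
Definition straight (l : seq (atom F)) : prog := line noop l.
Definition scratch (f : F) : bool := f.1.2.
Definition cscratch (f : F) : bool := ~~ f.1.2.

Definition rewind : prog :=
  Seq (straight [:: rd]) (While cscratch (straight (nseq K (go MoveL) ++ [:: rd]))).

Definition seek (j : nat) : prog :=
  Seq (straight (nseq (2 + 2 * j) (go MoveR) ++ [:: rd]))
      (While cscratch (straight (nseq K (go MoveR) ++ [:: rd]))).

Definition hact_core (a : hatom G) : atom F :=
  Act (fun f => h_coin a f.1.1)
      (fun f i w b => let: (g, mi, (wb, m)) := h_act a f.1.1 i w b in
                      ((g, f.1.2, m), mi, (wb, MoveS))).

Definition wrs (bs : seq bool) : seq (atom F) := [seq wr b MoveR | b <- bs].

Definition shift_right (j : nat) : prog :=
  Seq (straight (nseq (2 + 2 * j) (go MoveL) ++ [:: rd]))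
    (Ite scratch
      (straight (wr false MoveR :: nseq (K - 2) (go MoveR)
                 ++ wrs (blank_block J false false) ++ nseq (K - 1) (go MoveL)))
      (straight (nseq K (go MoveR)))).

Definition shift_left (j : nat) : prog :=
  Seq (straight (nseq (3 + 2 * j) (go MoveL) ++ [:: rd]))
    (Ite scratch
      (straight [:: go MoveR])
      (straight (nseq K (go MoveL) ++ [:: go MoveR]))).

Definition shift_home (j : nat) : prog :=
  Seq (straight (nseq (3 + 2 * j) (go MoveL))) (Seq rewind (straight [:: go MoveR])).

(** Every branch starts on the symbol cell of track [j] and stops at offset 1 of the block that the
    head moves to, so that one common tail can set the new mark. *)
Definition shift (j : nat) : prog :=
  Ite (fun f => f.2 == None) (shift_home j)
 (Ite (fun f => f.2 == Some MoveL) (shift_left j)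
 (Ite (fun f => f.2 == Some MoveR) (shift_right j)
   (straight (nseq (2 + 2 * j) (go MoveL))))).

(** Between atoms the physical head rests on cell 0. Each atom therefore finds its head mark by
    scanning from the left, and no position has to be remembered. *)
Definition hact (a : hatom G) : prog :=
  let j := h_tape a in
  Seq (seek j)
 (Seq (straight [:: wr false MoveR; hact_core a])
 (Seq (shift j)
 (Seq (straight (nseq (1 + 2 * j) (go MoveR) ++ [:: wr true MoveS]
                 ++ nseq (2 + 2 * j) (go MoveL)))
      rewind))).

Fixpoint lower (c : cmd (hatom G) G) : prog :=
  match c with
  | Atom a => hact a
  | Seq c1 c2 => Seq (lower c1) (lower c2)
  | Ite b c1 c2 => Ite (fun f => b f.1.1) (lower c1) (lower c2)
  | While b c1 => While (fun f => b f.1.1) (lower c1)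
  end.

Fixpoint tapes_below (c : cmd (hatom G) G) : Prop :=
  match c with
  | Atom a => h_tape a < J
  | Seq c1 c2 => tapes_below c1 /\ tapes_below c2
  | Ite b c1 c2 => tapes_below c1 /\ tapes_below c2
  | While b c1 => tapes_below c1
  end.

Variables x r : seq bool.
Notation sem := (tsem x r).
Notation runs := (runs (@t_mem F) sem).

Lemma runs_straight l s :
  runs (straight l) s (size l).+1 (foldl (fun s a => sem a s) s l).
Proof.
have := runs_line (@t_mem F) sem noop l s.
by rewrite /= sem_noop.
Qed.

Lemma sem_go f ip t p rp m :
  sem (go m) (TState f ip t p rp) = TState f ip t (mv m p (size t).-1) rp.
Proof. by rewrite /tsem /= write_cell_id addn0. Qed.

Lemma sem_wr f ip t p rp b m :
  sem (wr b m) (TState f ip t p rp) =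
  TState f ip (write_cell t p b) (mv m p (size t).-1) rp.
Proof. by rewrite /tsem /= addn0. Qed.

Lemma sem_rd f ip t p rp :
  sem rd (TState f ip t p rp) = TState (f.1.1, nth false t p, f.2) ip t p rp.
Proof. by rewrite /tsem /= write_cell_id addn0. Qed.

Lemma sem_right f ip t p rp : p.+1 < size t ->
  sem (go MoveR) (TState f ip t p rp) = TState f ip t p.+1 rp.
Proof. by move=> lt_p; rewrite sem_go /= (minn_idPl _) //; lia. Qed.

Lemma foldl_right n f ip t p rp : p + n < size t ->
  foldl (fun s a => sem a s) (TState f ip t p rp) (nseq n (go MoveR)) =
  TState f ip t (p + n) rp.
Proof.
elim: n p => [|n IH] p lt_p; first by rewrite addn0.
by rewrite [foldl _ _ _]/= sem_right ?IH ?addSnnS //; lia.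
Qed.

Lemma foldl_left n f ip t p rp :
  foldl (fun s a => sem a s) (TState f ip t p rp) (nseq n (go MoveL)) =
  TState f ip t (p - n) rp.
Proof.
elim: n p => [|n IH] p; first by rewrite subn0.
by rewrite /= sem_go /= IH -subn1 -subnDA add1n.
Qed.

Lemma foldl_wrs bs f ip t p rp : p + size bs < size t ->
  foldl (fun s a => sem a s) (TState f ip t p rp) (wrs bs) =
  TState f ip (overwrite t p bs) (p + size bs) rp.
Proof.
elim: bs t p => [|b bs IH] t p lt_p; first by rewrite addn0.
rewrite /= sem_wr /= (minn_idPl _); last by move: lt_p => /=; lia.
by rewrite IH ?addSnnS // size_write_cell; move: lt_p => /=; lia.
Qed.

Lemma runs_rewind g b m ip t rp top i : i <= top ->
  (forall i, i <= top -> nth false t (K * i) = (i == 0)) ->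
  runs rewind (TState (g, b, m) ip t (K * i) rp) ((K + 3) * top.+1)
    (TState (g, true, m) ip t 0 rp).
Proof.
move=> li flag.
pose I d s := d <= top /\ s = TState (g, d == 0, m) ip t (K * d) rp.
have [d s [ld ->]|_ [_ ->] //|s' R [_ e]] :=
  @runs_while _ _ _ (@t_mem F) sem I cscratch
    (straight (nseq K (go MoveL) ++ [:: rd])) (K + 2) _ _ i
    (TState (g, i == 0, m) ip t (K * i) rp) (conj li erefl).
  split=> //; exists (TState (g, d == 0, m) ip t (K * d) rp).
    have := runs_straight (nseq K (go MoveL) ++ [:: rd])
      (TState (g, d.+1 == 0, m) ip t (K * d.+1) rp).
    rewrite foldl_cat foldl_left size_cat size_nseq mulnS addKn [foldl _ _ _]/= sem_rd.
    by rewrite flag ?addn1 ?addn2 // ltnW.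
  by split=> //; apply: ltnW.
have {}e : s' = TState (g, true, m) ip t 0 rp by rewrite e muln0.
rewrite -e.
apply: runs_weaken (runs_seq (runs_straight [:: rd] _) _) _.
  by rewrite [foldl _ _ _]/= sem_rd flag //; apply: R.
by rewrite [size _]/=; nia.
Qed.

Lemma layout_first top t mk tp i : i <= top -> layout J top t mk tp ->
  nth false t (K * i) = (i == 0).
Proof. by move=> li lay; rewrite -[K * i]addn0 lay. Qed.

Lemma layout_last top t mk tp i : i <= top -> layout J top t mk tp ->
  nth false t (K * i + 1) = (i == top).
Proof. by move=> li lay; rewrite lay. Qed.

Lemma mulK_le i top : i <= top -> K * i <= K * top.
Proof. by rewrite leq_mul2l orbC => ->. Qed.

Lemma runs_seek j g b m ip t rp top tp hd : j < J -> hd j <= top ->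
  layout J top t (fun j i => hd j == i) tp -> K * top.+1 <= size t ->
  runs (seek j) (TState (g, b, m) ip t 0 rp) ((K + 3) * (top + 2))
    (TState (g, true, m) ip t (K * hd j + (2 + 2 * j)) rp).
Proof.
move=> lj lh lay lt.
have lo : 2 + 2 * j < K by rewrite /width; lia.
have in_tape i : i <= top -> K * i + (2 + 2 * j) < size t.
  by move=> /mulK_le; move: lt; rewrite mulnS; lia.
have mark i : i <= top -> nth false t (K * i + (2 + 2 * j)) = (hd j == i).
  move=> li; rewrite lay // /block_bit (_ : (2 + 2 * j - 2)./2 = j); last by lia.
  by rewrite oddD oddM.
pose I d s := d <= hd j /\
  s = TState (g, d == 0, m) ip t (K * (hd j - d) + (2 + 2 * j)) rp.
have [d s [ld ->]|_ [_ ->] //|s' R [_ e]] :=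
  @runs_while _ _ _ (@t_mem F) sem I cscratch
    (straight (nseq K (go MoveR) ++ [:: rd])) (K + 2) _ _ (hd j)
    (TState (g, hd j == 0, m) ip t (K * (hd j - hd j) + (2 + 2 * j)) rp)
    (conj (leqnn _) erefl).
  split=> //; exists (TState (g, d == 0, m) ip t (K * (hd j - d) + (2 + 2 * j)) rp).
    have := runs_straight (nseq K (go MoveR) ++ [:: rd])
      (TState (g, d.+1 == 0, m) ip t (K * (hd j - d.+1) + (2 + 2 * j)) rp).
    have e : K * (hd j - d.+1) + (2 + 2 * j) + K = K * (hd j - d) + (2 + 2 * j).
      by rewrite (_ : hd j - d = (hd j - d.+1).+1) ?mulnS; lia.
    rewrite foldl_cat foldl_right ?e; last by apply: in_tape; lia.
    rewrite size_cat size_nseq [foldl _ _ _]/= sem_rd mark; last by lia.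
    rewrite addn1 addn2 (_ : (hd j == hd j - d) = (d == 0)) //.
    by apply/eqP/eqP; lia.
  by split=> //; apply: ltnW.
rewrite e subn0 in R.
apply: runs_weaken (runs_seq (runs_straight _ _) _) _.
- rewrite foldl_cat foldl_right ?add0n; last by rewrite -[2 + _]add0n -{1}(muln0 K) in_tape.
  rewrite [foldl _ _ _]/= sem_rd -{1}[2 + _]add0n -{1}(muln0 K) mark //.
  by rewrite subnn muln0 add0n in R; exact: R.
- by rewrite size_cat size_nseq [size _]/=; nia.
Qed.

Lemma runs_shift j g b m ip t rp top mk tp i :
  j < J -> i <= top -> layout J top t mk tp -> K * (top + 3) <= size t ->
  (forall j, j < J -> mk j top.+1 = false /\ tp j top.+1 = false) ->
  exists b' t' top', [/\ layout J top' t' mk tp, size t' = size t,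
    hmv m i <= top', top <= top' <= top.+1 &
    runs (shift j) (TState (g, b, m) ip t (K * i + (3 + 2 * j)) rp)
      (5 * (K + 3) * (top + 2)) (TState (g, b', m) ip t' (K * hmv m i + 1) rp)].
Proof.
move=> lj li lay lt blank.
have lo : 3 + 2 * j < K by rewrite /width; lia.
have lKi := mulK_le li.
have e22 : K * i + (3 + 2 * j) - (2 + 2 * j) = K * i + 1 by lia.
have e33 : K * i + (3 + 2 * j) - (3 + 2 * j) = K * i by lia.
have lts : K * top + 3 * K <= size t by move: lt; rewrite mulnDr [K * 3]mulnC.
have cost : 10 * (K + 3) <= 5 * (K + 3) * (top + 2) by nia.
case: m => [[]|].
- case: i li lay lKi e22 e33 => [|i] li lay lKi e22 e33.
    exists true, t, top; split=> //; first by rewrite leqnn leqnSn.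
    rewrite /shift; apply: runs_weaken.
      apply: runs_iteF => //; apply: runs_iteT => //.
      apply: runs_seq; first exact: runs_straight.
      rewrite foldl_cat foldl_left e33 [foldl _ _ _]/= sem_rd (layout_first _ lay) //.
      apply: runs_iteT => //.
      have := runs_straight [:: go MoveR] (TState (g, true, Some MoveL) ip t (K * 0) rp).
      rewrite [foldl _ _ _]/= muln0 sem_right; last by lia.
      by move=> R; exact: R.
    by rewrite !(size_cat, size_nseq) /=; lia.
  exists false, t, top; split=> //; [exact: ltnW|by rewrite leqnn leqnSn|].
  rewrite /shift; apply: runs_weaken.
    apply: runs_iteF => //; apply: runs_iteT => //.
    apply: runs_seq; first exact: runs_straight.
    rewrite foldl_cat foldl_left e33 [foldl _ _ _]/= sem_rd (layout_first _ lay) //.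
    apply: runs_iteF => //.
    have := runs_straight (nseq K (go MoveL) ++ [:: go MoveR])
      (TState (g, false, Some MoveL) ip t (K * i.+1) rp).
    rewrite foldl_cat foldl_left mulnS addKn [foldl _ _ _]/= sem_right; last first.
      by move: lKi; rewrite mulnS; lia.
    by rewrite -mulnS addn1 => R; exact: R.
  by rewrite !(size_cat, size_nseq) /=; lia.
- exists b, t, top; split=> //; first by rewrite leqnn leqnSn.
  rewrite /shift; apply: runs_weaken.
    do 3 apply: runs_iteF => //.
    have := runs_straight (nseq (2 + 2 * j) (go MoveL))
      (TState (g, b, Some MoveS) ip t (K * i + (3 + 2 * j)) rp).
    by rewrite foldl_left e22 => R; exact: R.
  by rewrite !(size_cat, size_nseq) /=; lia.
- case: (ltngtP i top) (li) => // [lit _|ei _].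
    exists false, t, top; split=> //; first by rewrite leqnn leqnSn.
    rewrite /shift; apply: runs_weaken.
      do 2 apply: runs_iteF => //; apply: runs_iteT => //.
      apply: runs_seq; first exact: runs_straight.
      rewrite foldl_cat foldl_left e22 [foldl _ _ _]/= sem_rd (layout_last _ lay) ?(ltn_eqF lit) //.
      apply: runs_iteF => //.
      have := runs_straight (nseq K (go MoveR))
        (TState (g, false, Some MoveR) ip t (K * i + 1) rp).
      rewrite foldl_right; last by lia.
      by rewrite -addnA [1 + K]addnC addnA -mulnSr => R; exact: R.
    by rewrite !(size_cat, size_nseq) /=; lia.
  subst i.
  exists true, (overwrite (write_cell t (K * top + 1) false) (K * top.+1)
                    (blank_block J false false)), top.+1; split=> //.
  - by apply: (layout_extend _ lay blank); apply: leq_trans lt; rewrite leq_mul2l; lia.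
  - by rewrite size_overwrite size_write_cell.
  - by rewrite leqnSn leqnn.
  rewrite /shift; apply: runs_weaken.
    do 2 apply: runs_iteF => //; apply: runs_iteT => //.
    apply: runs_seq; first exact: runs_straight.
    rewrite foldl_cat foldl_left e22 [foldl _ _ _]/= sem_rd (layout_last _ lay) // eqxx.
    apply: runs_iteT => //.
    have := runs_straight (wr false MoveR :: nseq (K - 2) (go MoveR)
       ++ wrs (blank_block J false false) ++ nseq (K - 1) (go MoveL))
      (TState (g, true, Some MoveR) ip t (K * top + 1) rp).
    rewrite -cat1s foldl_cat [foldl _ _ [:: _]]/= sem_wr.
    rewrite (_ : mv _ _ _ = K * top + 2); last by rewrite /= (minn_idPl _); lia.
    rewrite foldl_cat foldl_right ?size_write_cell; last by lia.
    rewrite (_ : K * top + 2 + (K - 2) = K * top.+1); last by rewrite mulnS; lia.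
    rewrite foldl_cat foldl_wrs ?size_write_cell; last by rewrite size_blank_block mulnS; lia.
    rewrite foldl_left size_blank_block.
    rewrite (_ : K * top.+1 + K - (K - 1) = K * top.+1 + 1); last by lia.
    by move=> R; exact: R.
  by rewrite !(size_cat, size_nseq, size_map) size_blank_block /=; lia.
- exists true, t, top; split=> //; first by rewrite leqnn leqnSn.
  rewrite /shift; apply: runs_weaken.
    apply: runs_iteT => //; apply: runs_seq; first exact: runs_straight.
    rewrite foldl_left e33; apply: runs_seq.
      exact: (runs_rewind _ _ _ _ _ li (fun i li => layout_first li lay)).
    have := runs_straight [:: go MoveR] (TState (g, true, None) ip t 0 rp).
    rewrite [foldl _ _ _]/= sem_right; last by lia.
    by rewrite /= muln0 => R; exact: R.
  by rewrite size_nseq /=; nia.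
Qed.

(** The last clause, blank tracks beyond [top], is what allows the next block to be cleared when a
    head enters it. *)
Definition represents (s : tstate F) (h : hstate G) (top : nat) : Prop :=
  [/\ [/\ (t_mem s).1.1 = hg h, t_ip s = hip h, t_rp s = hrp h & t_pos s = 0],
    layout J top (t_tape s) (fun j i => hhd h j == i) (htp h),
    forall j, j < J -> hhd h j <= top
  & forall j i, j < J -> top < i -> htp h j i = false].

Lemma layout_ext top t mk mk' tp : mk =2 mk' ->
  layout J top t mk tp -> layout J top t mk' tp.
Proof. by move=> e lay i o li lo; rewrite lay // /block_bit e. Qed.

Lemma runs_hact a s h top : h_tape a < J -> represents s h top ->
  K * (top + 3) <= size (t_tape s) ->
  exists s' top', [/\ runs (hact a) s (20 * (K + 3) * (top + 2)) s',
    represents s' (hsem x r a h) top', top' <= top.+1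
    & size (t_tape s') = size (t_tape s)].
Proof.
case: s => [[[g b] m] ip t p rp] lj [[/= eg eip erp ->] lay hd_le blank] lt.
subst g ip rp; set j := h_tape a in lj *; set i := hhd h j.
have li : i <= top by apply: hd_le.
have lo : 3 + 2 * j < K by rewrite /width; lia.
have lts : K * top + 3 * K <= size t by move: lt; rewrite mulnDr [K * 3]mulnC.
have lKi := mulK_le li.
have lt1 : K * top.+1 <= size t by rewrite mulnS; lia.
pose bt := if h_coin a (hg h) then Some (nth false r (hrp h)) else None.
case ea: (h_act a (hg h) (input_symbol x (hip h)) (htp h j i) bt) => [[g' mi] [wb m']].
set t1 := write_cell t (K * i + (2 + 2 * j)) false.
set t2 := write_cell t1 (K * i + (3 + 2 * j)) wb.
have sz1 : size t1 = size t by rewrite size_write_cell.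
have sz2 : size t2 = size t by rewrite size_write_cell.
pose mk j' i' := hhd h j' == i'.
(* While the head of track [j] is in transit, that track carries no mark at all. *)
pose mk1 := upd mk j (upd (mk j) i false).
pose tp2 := upd (htp h) j (upd (htp h j) i wb).
have lay1 : layout J top t1 mk1 (htp h) := layout_mark false li lj lt1 lay.
have lay2 : layout J top t2 mk1 tp2.
  by apply: (layout_sym wb li lj _ lay1); rewrite sz1.
have blank2 j' : j' < J -> mk1 j' top.+1 = false /\ tp2 j' top.+1 = false.
  move=> lj'; rewrite /mk1 /tp2 /upd /mk.
  have := hd_le _ lj'; have := blank _ top.+1 lj' (ltnSn _).
  case: (j' =P j) => [->|_] -> le_hd; last by split=> //; apply/eqP; lia.
  by rewrite !ifN ?(gtn_eqF (_ : i < top.+1)) //; split=> //; apply/eqP; rewrite -/i; lia.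
have lt2 : K * (top + 3) <= size t2 by rewrite sz2.
have [b3 [t3 [top' [lay3 sz3 lm le_top R3]]]] := runs_shift g' true m'
  (mv mi (hip h) (size x).+1) (hrp h + h_coin a (hg h)) lj li lay2 lt2 blank2.
set i' := hmv m' i in lm R3.
have lj2 : 2 + 2 * j < K by rewrite /width; lia.
have li' : K * i' <= K * top.+1 by apply: mulK_le; lia.
have lt3 : K * top'.+1 <= size t3.
  rewrite sz3 sz2; apply: leq_trans lt; rewrite leq_mul2l; lia.
set t4 := write_cell t3 (K * i' + (2 + 2 * j)) true.
have lay4 : layout J top' t4 _ tp2 := layout_mark true lm lj lt3 lay3.
have ecore : sem (hact_core a) (TState (hg h, true, m) (hip h) t1 (K * i + (3 + 2 * j)) (hrp h))
    = TState (g', true, m') (mv mi (hip h) (size x).+1) t2 (K * i + (3 + 2 * j))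
        (hrp h + h_coin a (hg h)).
  rewrite /tsem /= lay1 // /block_bit (_ : (3 + 2 * j - 2)./2 = j); last by lia.
  by rewrite oddD oddM /= -/bt ea.
exists (TState (g', true, m') (mv mi (hip h) (size x).+1) t4 0 (hrp h + h_coin a (hg h))), top'.
split.
- rewrite /hact -/j; apply: runs_weaken.
    apply: runs_seq; first exact: runs_seek (hd_le _ lj) lay lt1.
    apply: runs_seq; first exact: runs_straight.
    rewrite -/i -[foldl _ _ _]/(sem (hact_core a) (sem (wr false MoveR) _)) sem_wr.
    rewrite (_ : mv _ _ _ = K * i + (3 + 2 * j)); last first.
      by rewrite /= (minn_idPl _); lia.
    rewrite ecore.
    apply: runs_seq; first exact: R3.
    apply: runs_seq; first exact: runs_straight.
    rewrite foldl_cat foldl_right; last by lia.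
    rewrite -cat1s foldl_cat -[foldl _ _ [:: _]]/(sem (wr true MoveS) _) sem_wr
      [mv _ _ _]/= foldl_left.
    rewrite (_ : K * i' + 1 + _ = K * i' + (2 + 2 * j)); last by lia.
    rewrite (_ : K * i' + _ - _ = K * i'); last by lia.
    exact: runs_rewind lm (fun k lk => layout_first lk lay4).
  have cost : 2 * (K + 3) <= (K + 3) * (top + 2) by nia.
  have cost' : (K + 3) * top'.+1 <= (K + 3) * (top + 2) by rewrite leq_mul2l; lia.
  rewrite -!mulnA; move: cost cost'; set X := (K + 3) * (top + 2).
  by rewrite !(size_cat, size_nseq) /=; lia.
- rewrite /hsem -/j -/i -/bt ea; split=> //=.
  + apply: layout_ext lay4 => j' k; rewrite /upd /mk1 /upd /mk.
    case: (j' =P j) => [_|_] //; rewrite !eqxx -/i -/i'.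
    case: (k =P i') => [->|/eqP/negbTE ne]; first by rewrite eqxx.
    by rewrite [i' == k]eq_sym ne; case: (k =P i) => // /eqP; rewrite eq_sym => /negbTE.
  + move=> j' lj'; rewrite /upd; case: eqP => [_|_] //.
    by apply: leq_trans (hd_le _ lj') _; case/andP: le_top.
  + move=> j' k lj' lk; have {}lk : top < k by lia.
    rewrite /tp2 /upd; case: eqP => [_|_]; last exact: blank.
    by rewrite gtn_eqF ?blank //; lia.
- by case/andP: le_top.
- by rewrite size_write_cell sz3.
Qed.

(** The overhead is quadratic: each abstract step moves the frontier by at most one block and costs
    a bounded number of sweeps over the blocks in use. The same count bounds the tape needed. *)
Lemma runs_lower c h n h' : exec (@hg G) (hsem x r) c h n h' -> tapes_below c ->
  forall s top, represents s h top -> K * (top + n + 2) <= size (t_tape s) ->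
  exists s' top', [/\ runs (lower c) s (n * (20 * (K + 3) * (top + n + 2))) s',
    represents s' h' top', top' <= top + n
    & size (t_tape s') = size (t_tape s)].
Proof.
set D := 20 * (K + 3).
have D0 : 0 < D by [].
elim=> {c h n h'} [a h|c1 c2 h n h1 m h2 _ IH1 _ IH2|b c1 c2 h n h1 bT _ IH
  |b c1 c2 h n h1 bF _ IH|b c h n h1 m h2 bT _ IH1 _ IH2|b c h bF] /=.
- move=> lj s top rep; rewrite -addnA => lt.
  have [s' [top' [R rep' le_top sz]]] := runs_hact lj rep lt.
  exists s', top'; split=> //; last by rewrite addn1.
  by apply: runs_weaken R _; rewrite mul1n leq_mul2l; lia.
- move=> [b1 b2] s top rep lt.
  have [|s1 [top1 [R1 rep1 le1 sz1]]] := IH1 b1 s top rep.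
    by apply: leq_trans lt; rewrite leq_mul2l; lia.
  have [|s2 [top2 [R2 rep2 le2 sz2]]] := IH2 b2 s1 top1 rep1.
    by rewrite sz1; apply: leq_trans lt; rewrite leq_mul2l; lia.
  exists s2, top2; split=> //; [|by lia|by rewrite sz2].
  apply: runs_weaken (runs_seq R1 R2) _.
  by rewrite mulnDl leq_add // leq_mul2l leq_mul2l; lia.
- move=> [b1 b2] s top rep lt.
  have [|s1 [top1 [R1 rep1 le1 sz1]]] := IH b1 s top rep.
    by apply: leq_trans lt; rewrite leq_mul2l; lia.
  exists s1, top1; split=> //; [|by lia].
  apply: runs_weaken (runs_iteT _ _ R1) _; first by case: rep => -[->].
  by rewrite mulSn; have := leq_mul2l D; nia.
- move=> [b1 b2] s top rep lt.
  have [|s1 [top1 [R1 rep1 le1 sz1]]] := IH b2 s top rep.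
    by apply: leq_trans lt; rewrite leq_mul2l; lia.
  exists s1, top1; split=> //; [|by lia].
  apply: runs_weaken (runs_iteF _ _ R1) _; first by case: rep => -[->].
  by rewrite mulSn; nia.
- move=> bl s top rep lt.
  have [|s1 [top1 [R1 rep1 le1 sz1]]] := IH1 bl s top rep.
    by apply: leq_trans lt; rewrite leq_mul2l; lia.
  have [|s2 [top2 [R2 rep2 le2 sz2]]] := IH2 bl s1 top1 rep1.
    by rewrite sz1; apply: leq_trans lt; rewrite leq_mul2l; lia.
  exists s2, top2; split=> //; [|by lia|by rewrite sz2].
  apply: runs_weaken (runs_whileT _ R1 R2) _; first by case: rep => -[->].
  have l1 : n * (D * (top + n + 2)) <= n * (D * (top + (n + m).+1 + 2)).
    by rewrite leq_mul2l leq_mul2l; lia.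
  have l2 : m * (D * (top1 + m + 2)) <= m * (D * (top + (n + m).+1 + 2)).
    by rewrite leq_mul2l leq_mul2l; lia.
  have l3 : 0 < D * (top + (n + m).+1 + 2) by rewrite muln_gt0; lia.
  by rewrite mulSn mulnDl; lia.
- move=> bl s top rep lt; exists s, top; split=> //; last by lia.
  apply: runs_weaken (runs_whileF _ _ _) _; first by case: rep => -[->].
  by rewrite mul1n muln_gt0; lia.
Qed.

Definition setup : prog :=
  straight (wrs (blank_block J true true) ++ nseq K (go MoveL)).

Definition blank_hstate (g : G) (rp : nat) : hstate G :=
  HState g 0 (fun _ _ => false) (fun _ => 0) rp.

Lemma runs_setup f t rp : K < size t ->
  exists2 s', runs setup (TState f 0 t 0 rp) (2 * K + 1) s' &
    represents s' (blank_hstate f.1.1 rp) 0 /\ size (t_tape s') = size t.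
Proof.
move=> lt; exists (TState f 0 (overwrite t 0 (blank_block J true true)) 0 rp).
  have := runs_straight (wrs (blank_block J true true) ++ nseq K (go MoveL))
    (TState f 0 t 0 rp).
  rewrite foldl_cat foldl_wrs size_blank_block ?add0n // foldl_left subnn.
  by rewrite size_cat size_map size_blank_block size_nseq addn1 mul2n addnn.
split; last by rewrite size_overwrite.
split=> //=; apply: layout_init; last by move=> j _.
exact: ltnW.
Qed.

End Lowering.

(** * Unary arithmetic and simulation of a machine *)

Lemma updK (T : Type) (f : nat -> T) i : upd f i (f i) = f.
Proof. by apply/funext => j; rewrite /upd; case: eqP => [->|]. Qed.

Lemma upd_upd (T : Type) (f : nat -> T) i a b : upd (upd f i a) i b = upd f i b.
Proof. by apply/funext => j; rewrite /upd; case: eqP. Qed.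

Lemma updC (T : Type) (f : nat -> T) i j a b : i != j ->
  upd (upd f i a) j b = upd (upd f j b) i a.
Proof.
move=> ne; apply/funext => l; rewrite /upd; case: eqP => [->|//].
by rewrite eq_sym (negbTE ne).
Qed.

Lemma upd_eq (T : Type) (f : nat -> T) i a : upd f i a i = a.
Proof. by rewrite /upd eqxx. Qed.

Lemma upd_ne (T : Type) (f : nat -> T) i j a : j != i -> upd f i a j = f j.
Proof. by rewrite /upd => /negbTE ->. Qed.

Section Memory.
Variables (Q : finType) (N : nat).

(** [m_q], [m_i], [m_w] and [m_c] hold the simulated state and the three scanned symbols; [m_cw],
    [m_mw] and [m_mc] hold the part of a transition not yet carried out; [m_b] is the loop bit of
    the unary arithmetic; [m_v] counts the accepting trials; [m_ans] is an answer that overrides the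
    vote. *)
Record memory := Memory {
  m_q : Q; m_i : option bool; m_w : bool; m_c : bool; m_cw : bool;
  m_mw : move; m_mc : move; m_b : bool; m_v : 'I_N.+1; m_ans : option bool }.

Definition mem_code (g : memory) :=
  (m_q g, m_i g, (m_w g, m_c g, m_cw g), (m_mw g, m_mc g), (m_b g, m_v g, m_ans g)).
Definition mem_decode c :=
  let: (q, i, (w, c, cw), (mw, mc), (b, v, a)) := c in Memory q i w c cw mw mc b v a.
Lemma mem_codeK : cancel mem_code mem_decode. Proof. by case. Qed.
HB.instance Definition _ := Finite.copy memory (can_type mem_codeK).

Definition set_bi (g : memory) (b : bool) (i : option bool) : memory :=
  Memory (m_q g) i (m_w g) (m_c g) (m_cw g) (m_mw g) (m_mc g) b (m_v g) (m_ans g).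

End Memory.

Section Trial.
Variables (M : TM) (k N : nat).
Notation mem := (memory (tm_state M) N).
Notation hatom := (hatom mem).
Notation prog := (cmd hatom mem).

Definition calm (g : mem) := false.
Definition h_move j (m : option move) : hatom :=
  HAct j calm (fun g _ w _ => (g, MoveS, (w, m))).
Definition h_cmove j (m : move) : hatom :=
  HAct j calm (fun g _ w _ => (g, MoveS, (w, Some (if m_b g then MoveS else m)))).
Definition h_read j : hatom :=
  HAct j calm (fun g _ w _ => (set_bi g w (m_i g), MoveS, (w, Some MoveS))).
Definition h_write j b : hatom :=
  HAct j calm (fun g _ w _ => (g, MoveS, (b, Some MoveS))).
Definition h_input j (m : move) : hatom :=
  HAct j calm (fun g _ w _ => (g, m, (w, Some MoveS))).
Definition h_sense j : hatom :=
  HAct j calm (fun g i w _ => (set_bi g (m_b g) i, MoveS, (w, Some MoveS))).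
Definition h_mem j (f : mem -> mem) : hatom :=
  HAct j calm (fun g _ w _ => (f g, MoveS, (w, Some MoveS))).

Definition bit_unset (g : mem) := ~~ m_b g.
Definition sensed (g : mem) := isSome (m_i g).

Variables x r : seq bool.
Notation n := (size x).
Notation sem := (hsem x r).
Notation runs := (runs (@hg mem) sem).

Lemma sem_move j m g ip tp hd rp : sem (h_move j m) (HState g ip tp hd rp) =
  HState g ip tp (upd hd j (hmv m (hd j))) rp.
Proof. by rewrite /hsem /= !updK addn0. Qed.

Lemma sem_cmove j m g ip tp hd rp : sem (h_cmove j m) (HState g ip tp hd rp) =
  HState g ip tp (if m_b g then hd else upd hd j (hmv (Some m) (hd j))) rp.
Proof. by rewrite /hsem /= !updK addn0; case: ifP => //= _; rewrite updK. Qed.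

Lemma sem_read j g ip tp hd rp : sem (h_read j) (HState g ip tp hd rp) =
  HState (set_bi g (tp j (hd j)) (m_i g)) ip tp hd rp.
Proof. by rewrite /hsem /= !updK addn0. Qed.

Lemma sem_write j b g ip tp hd rp : sem (h_write j b) (HState g ip tp hd rp) =
  HState g ip (upd tp j (upd (tp j) (hd j) b)) hd rp.
Proof. by rewrite /hsem /= updK addn0. Qed.

Lemma sem_input j m g ip tp hd rp : sem (h_input j m) (HState g ip tp hd rp) =
  HState g (mv m ip n.+1) tp hd rp.
Proof. by rewrite /hsem /= !updK addn0. Qed.

Lemma sem_sense j g ip tp hd rp : sem (h_sense j) (HState g ip tp hd rp) =
  HState (set_bi g (m_b g) (input_symbol x ip)) ip tp hd rp.
Proof. by rewrite /hsem /= !updK addn0. Qed.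

Lemma sem_mem j f g ip tp hd rp : sem (h_mem j f) (HState g ip tp hd rp) =
  HState (f g) ip tp hd rp.
Proof. by rewrite /hsem /= !updK addn0. Qed.

Definition semE := (sem_move, sem_cmove, sem_read, sem_write, sem_input, sem_sense, sem_mem).

Lemma set_biK g b i b' i' : set_bi (set_bi g b i) b' i' = set_bi g b' i' :> mem.
Proof. by []. Qed.

Lemma isSome_input p : isSome (input_symbol x p) = (0 < p <= n).
Proof. by rewrite /input_symbol; case: ifP. Qed.

Section Programs.
Variable B : nat.
(** A trial owns the [6 + k] tracks from [B] on: the simulated work and catalytic tapes [tW] and
    [tC], the counters [tA] and [tQ], and the tracks [tWE] and [tCE] that mark the last cells of the
    simulated tapes. The latter is the final one among [tP 0], ..., [tP k], which represent the
    powers of [n]. *)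
Definition tW := B.
Definition tWE := B + 1.
Definition tC := B + 2.
Definition tA := B + 3.
Definition tQ := B + 4.
Definition tP j := B + 5 + j.
Definition tCE := tP k.

(** Both ends of the input read [None]. One move to the left before the first test rules out the
    right end. *)
Definition go_home : prog :=
  Seq (line (h_input tW MoveL) [:: h_sense tW])
      (While sensed (line (h_input tW MoveL) [:: h_sense tW])).

Lemma runs_go_home g b i ip tp hd rp : ip <= n.+1 ->
  runs go_home (HState (set_bi g b i) ip tp hd rp) (3 * n + 3)
    (HState (set_bi g b None) 0 tp hd rp).
Proof.
move=> lip.
pose I d s := d <= n /\ s = HState (set_bi g b (input_symbol x d)) d tp hd rp.
have l0 : ip.-1 <= n by lia.
have [d s [ld ->]|s [_ ->] //|s' R [_ e]] := @runs_while _ _ _ (@hg mem) sem I sensed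
   (line (h_input tW MoveL) [:: h_sense tW]) 2 _ _ ip.-1 _ (conj l0 erefl).
  split; first by rewrite /sensed isSome_input.
  exists (HState (set_bi g b (input_symbol x d)) d tp hd rp); last by split=> //; exact: ltnW.
  have := runs_line (@hg mem) sem (h_input tW MoveL) [:: h_sense tW]
    (HState (set_bi g b (input_symbol x d.+1)) d.+1 tp hd rp).
  by rewrite [foldl _ _ _]/= !semE.
apply: runs_weaken.
  apply: runs_seq; first exact: runs_line.
  by rewrite [foldl _ _ _]/= !semE; rewrite e in R; exact: R.
by rewrite /=; lia.
Qed.

(** Counters are head positions, and the 1 written in cell 0 serves as zero test. The two initial
    moves skip the first symbol, so the head of [tA] stops at [n - 1]. *)
Definition count_input : prog :=
  Seq (line (h_write tA true) [:: h_write tQ true; h_input tW MoveR; h_input tW MoveR; h_sense tW])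
      (While sensed (line (h_move tA (Some MoveR)) [:: h_input tW MoveR; h_sense tW])).

(** A round takes two units from [tA] and gives one to [tQ]. The conditional moves do nothing once
    [tA] has reached 0, so an odd last unit is dropped and the quotient is rounded down. *)
Definition halve : prog :=
  While bit_unset
    (line (h_move tA (Some MoveL))
      [:: h_read tA; h_cmove tQ MoveR; h_cmove tA MoveL; h_read tA]).

Definition restore : prog :=
  Seq (line (h_read tQ) [::])
      (While bit_unset
        (line (h_move tQ (Some MoveL)) [:: h_move tA (Some MoveR); h_read tQ])).

(* Halving [n - 1] down to 0 takes [up_log 2 n] rounds, each of which advances
   the head of [tWE] by [k] cells. *)
Definition log_loop : prog :=
  Seq (line (h_read tA) [::])
      (While bit_unset
        (Seq (line (h_read tA) (nseq k (h_move tWE (Some MoveR))))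
        (Seq halve (Seq restore (line (h_read tA) [::]))))).

Definition logarithm : prog :=
  Seq count_input (Seq go_home (Seq log_loop
    (line (h_move tWE (Some MoveL)) [:: h_write tWE true; h_move tWE None]))).

Section LogSpec.
Variables (g : mem) (tp : nat -> nat -> bool) (hd : nat -> nat) (rp : nat).
Hypothesis tpA : forall i, tp tA i = (i == 0).
Hypothesis tpQ : forall i, tp tQ i = (i == 0).

Definition hd3 a q w := upd (upd (upd hd tWE w) tA a) tQ q.

Lemma ne_AQ : tA != tQ. Proof. by rewrite /tA /tQ eqn_add2l. Qed.
Lemma ne_WEA : tWE != tA. Proof. by rewrite /tWE /tA eqn_add2l. Qed.
Lemma ne_WEQ : tWE != tQ. Proof. by rewrite /tWE /tQ eqn_add2l. Qed.

Lemma hd3A a q w : hd3 a q w tA = a.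
Proof. by rewrite /hd3 (upd_ne _ _ ne_AQ) upd_eq. Qed.
Lemma hd3Q a q w : hd3 a q w tQ = q.
Proof. by rewrite /hd3 upd_eq. Qed.
Lemma hd3WE a q w : hd3 a q w tWE = w.
Proof. by rewrite /hd3 (upd_ne _ _ ne_WEQ) (upd_ne _ _ ne_WEA) upd_eq. Qed.
Lemma upd_hd3A a q w a' : upd (hd3 a q w) tA a' = hd3 a' q w.
Proof. by rewrite /hd3 -(updC _ _ _ ne_AQ) upd_upd. Qed.
Lemma upd_hd3Q a q w q' : upd (hd3 a q w) tQ q' = hd3 a q' w.
Proof. by rewrite /hd3 upd_upd. Qed.
Lemma upd_hd3WE a q w w' : upd (hd3 a q w) tWE w' = hd3 a q w'.
Proof. by rewrite /hd3 -(updC _ _ _ ne_WEQ) -(updC _ _ _ ne_WEA) upd_upd. Qed.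
Definition hd3E := (hd3A, hd3Q, hd3WE, upd_hd3A, upd_hd3Q, upd_hd3WE).

Notation st b a q w := (HState (set_bi g b None) 0 tp (hd3 a q w) rp).

Lemma runs_halve a w :
  runs halve (st (a == 0) a 0 w) (6 * a + 1) (st true 0 a./2 w).
Proof.
(* [uphalf c] rounds remain: each removes two units, except that the last may remove only one. *)
pose I d s := exists c q, [/\ uphalf c = d, q + c./2 = a./2 & s = st (c == 0) c q w].
have I0 : I (uphalf a) (st (a == 0) a 0 w) by exists a, 0.
have [d s [c [q [ed eq ->]]]|s [c [q [ed _ ->]]]|s' R [c [q [ed eq e]]]] :=
  @runs_while _ _ _ (@hg mem) sem I bit_unset
   (line (h_move tA (Some MoveL))
      [:: h_read tA; h_cmove tQ MoveR; h_cmove tA MoveL; h_read tA]) 5 _ _ _ _ I0.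
- split; first by rewrite /bit_unset /=; move: ed; case: (c).
  exists (st (c.-2 == 0) c.-2 (q + (1 < c)) w); last first.
    exists c.-2, (q + (1 < c)); split=> //; move: ed eq; case: (c) => [|[|c']] //=; lia.
  have := runs_line (@hg mem) sem (h_move tA (Some MoveL))
      [:: h_read tA; h_cmove tQ MoveR; h_cmove tA MoveL; h_read tA] (st (c == 0) c q w).
  rewrite [foldl _ _ _]/= !semE /= !hd3E !tpA.
  case: c ed eq => [|[|c']] //= _ _; rewrite !hd3E ?tpA ?addn0 ?addn1 //.
- by case: c ed => [|[|]].
have ec : c = 0 by move: ed; case: (c) => [|[|]].
rewrite ec addn0 in eq; subst c q.
by rewrite e in R; apply: runs_weaken R _; lia.
Qed.

Lemma runs_restore b q w :
  runs restore (st b 0 q w) (4 * q + 2) (st true q 0 w).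
Proof.
pose I d s := d <= q /\ s = st (d == 0) (q - d) d w.
have I0 : I q (st (q == 0) 0 q w) by rewrite /I subnn.
have [d s [ld ->]|s [_ ->] //|s' R [_ e]] :=
  @runs_while _ _ _ (@hg mem) sem I bit_unset
   (line (h_move tQ (Some MoveL)) [:: h_move tA (Some MoveR); h_read tQ]) 3 _ _ _ _ I0.
  split=> //; exists (st (d == 0) (q - d) d w); last by split=> //; lia.
  have := runs_line (@hg mem) sem (h_move tQ (Some MoveL))
    [:: h_move tA (Some MoveR); h_read tQ] (st (d.+1 == 0) (q - d.+1) d.+1 w).
  by rewrite [foldl _ _ _]/= !semE /= !hd3E tpQ subnSK.
rewrite subn0 in e; rewrite e in R.
apply: runs_weaken.
  apply: runs_seq; first exact: runs_line.
  by rewrite [foldl _ _ _]/= !semE hd3E tpQ; exact: R.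
by rewrite /=; lia.
Qed.

Lemma foldl_moves l b a q w :
  foldl (fun s a => sem a s) (st b a q w) (nseq l (h_move tWE (Some MoveR))) =
  st b a q (w + l).
Proof.
elim: l w => [|l IH] w; first by rewrite addn0.
by rewrite /= semE /= !hd3E IH addSnnS.
Qed.

Lemma runs_log_loop b a :
  runs log_loop (st b a 0 0) (up_log 2 a.+1 * (10 * a + k + 20) + 2)
    (st true 0 0 (k * up_log 2 a.+1)).
Proof.
pose I d s := exists c w, [/\ c <= a, up_log 2 c.+1 = d,
  w + k * up_log 2 c.+1 = k * up_log 2 a.+1 & s = st (c == 0) c 0 w].
have I0 : I (up_log 2 a.+1) (st (a == 0) a 0 0) by exists a, 0.
have [d s [c [w [lc ed ew ->]]]|s [c [w [lc ed _ ->]]]|s' R [c [w [lc ed ew e]]]] :=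
  @runs_while _ _ _ (@hg mem) sem I bit_unset
   (Seq (line (h_read tA) (nseq k (h_move tWE (Some MoveR))))
        (Seq halve (Seq restore (line (h_read tA) [::])))) (10 * a + k + 19) _ _ _ _ I0.
- have c0 : 0 < c by case: (c) ed => //; rewrite up_log1.
  split; first by rewrite /bit_unset /= -lt0n.
  exists (st (c./2 == 0) c./2 0 (w + k)); last first.
    (* For positive [c], the logarithm of [c.+1] exceeds that of [c./2.+1] by exactly one, which
       pays for this round. *)
    exists c./2, (w + k); move: ed ew; rewrite up_log2S // => -[ed] ew; split=> //; first by lia.
    by rewrite -addnA -mulnS.
  apply: runs_weaken.
    apply: runs_seq; first exact: runs_line.
    rewrite -cat1s foldl_cat [foldl _ _ [:: _]]/= semE hd3E tpA foldl_moves.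
    apply: runs_seq; first exact: runs_halve.
    apply: runs_seq; first exact: runs_restore.
    have := runs_line (@hg mem) sem (h_read tA) [::] (st true c./2 0 (w + k)).
    by rewrite [foldl _ _ _]/= !semE hd3E tpA => R; exact: R.
  by rewrite size_nseq /=; lia.
- move: ed; case: (c) => // c' /eqP; rewrite up_log_eq0 //.
have c0 : c = 0 by move: ed; case: (c) => // c' /eqP; rewrite up_log_eq0.
subst c; rewrite up_log1 muln0 addn0 in ew; subst w.
rewrite e in R; apply: runs_weaken.
  apply: runs_seq; first exact: runs_line.
  by rewrite [foldl _ _ _]/= !semE hd3E tpA; exact: R.
by rewrite /=; lia.
Qed.

End LogSpec.

Lemma runs_count_input g b i tp hd rp : 1 < n -> hd tA = 0 -> hd tQ = 0 ->
  runs count_input (HState (set_bi g b i) 0 tp hd rp) (4 * n + 6)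
    (HState (set_bi g b None) n.+1
      (upd (upd tp tA (upd (tp tA) 0 true)) tQ (upd (tp tQ) 0 true))
      (upd hd tA n.-1) rp).
Proof.
move=> n1 hA hQ; set tp' := upd (upd tp _ _) _ _.
pose I d s := d < n /\ s = HState (set_bi g b (input_symbol x (n.+1 - d))) (n.+1 - d) tp'
                        (upd hd tA (n.-1 - d)) rp.
have I0 : I n.-1 (HState (set_bi g b (input_symbol x 2)) 2 tp' hd rp).
  split; first by lia.
  rewrite subnn (_ : n.+1 - n.-1 = 2); last by lia.
  by have -> : upd hd tA 0 = hd by rewrite -hA updK.
have [d s [ld ->]|s [_ ->]|s' R [_ e]] :=
  @runs_while _ _ _ (@hg mem) sem I sensed
   (line (h_move tA (Some MoveR)) [:: h_input tW MoveR; h_sense tW]) 3 _ _ _ _ I0.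
- split; first by rewrite /sensed isSome_input; lia.
  exists (HState (set_bi g b (input_symbol x (n.+1 - d))) (n.+1 - d) tp'
    (upd hd tA (n.-1 - d)) rp); last by split=> //; lia.
  have := runs_line (@hg mem) sem (h_move tA (Some MoveR)) [:: h_input tW MoveR; h_sense tW]
    (HState (set_bi g b (input_symbol x (n.+1 - d.+1))) (n.+1 - d.+1) tp'
      (upd hd tA (n.-1 - d.+1)) rp).
  rewrite [foldl _ _ _]/= !semE /= upd_upd upd_eq.
  rewrite (_ : minn _ _ = n.+1 - d); last by lia.
  by rewrite (_ : (n.-1 - d.+1).+1 = n.-1 - d) //; lia.
- by rewrite /sensed isSome_input; lia.
rewrite !subn0 /input_symbol ltnn andbF in e.
rewrite e in R; apply: runs_weaken.
  apply: runs_seq; first exact: runs_line.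
  rewrite [foldl _ _ _]/= !semE /= hA hQ (upd_ne _ _ (_ : tQ != tA)); last first.
    by rewrite eq_sym ne_AQ.
  have -> : minn (minn 1 n.+1).+1 n.+1 = 2 by lia.
  exact: R.
by rewrite /=; lia.
Qed.

Lemma runs_logarithm g b i tp hd rp : 1 < n ->
  (forall j, j \in [:: tA; tQ; tWE] -> hd j = 0 /\ forall p, tp j p = false) ->
  exists2 tp', runs logarithm (HState (set_bi g b i) 0 tp hd rp)
      (up_log 2 n * (10 * n + k + 20) + 7 * n + 20) (HState (set_bi g true None) 0 tp' hd rp)
    & (forall p, tp' tWE p = (p == (k * up_log 2 n).-1)) /\
      forall j, j \notin [:: tA; tQ; tWE] -> tp' j = tp j.
Proof.
move=> n1 blank.
have [|hA tA0] := blank tA; first by rewrite !inE eqxx.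
have [|hQ tQ0] := blank tQ; first by rewrite !inE eqxx orbT.
have [|hW tW0] := blank tWE; first by rewrite !inE eqxx !orbT.
set tp1 := upd (upd tp tA (upd (tp tA) 0 true)) tQ (upd (tp tQ) 0 true).
have ehd a : upd hd tA a = hd3 hd a 0 0.
  have neQA : tQ != tA by rewrite eq_sym ne_AQ.
  have eW : upd hd tWE 0 = hd by rewrite -hW updK.
  by rewrite /hd3 eW -{1}(updK (upd hd tA a) tQ) (upd_ne _ _ neQA) hQ.
have e0 : hd3 hd 0 0 0 = hd by rewrite -ehd -hA updK.
have tp1A p : tp1 tA p = (p == 0).
  by rewrite /tp1 (upd_ne _ _ ne_AQ) upd_eq /upd tA0; case: eqP.
have tp1Q p : tp1 tQ p = (p == 0).
  by rewrite /tp1 upd_eq /upd tQ0; case: eqP.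
(* Heads are clamped at [(size t).-1], so the mark sits there. The truncated predecessor also gives
   the right clamp, 0, for the empty tape of the case [k = 0]. *)
set s := (k * up_log 2 n).-1.
exists (upd tp1 tWE (upd (tp1 tWE) s true)); last first.
  split=> [p|j]; first rewrite upd_eq /upd /tp1 (upd_ne _ _ ne_WEQ) (upd_ne _ _ ne_WEA) tW0.
    by case: eqP.
  by rewrite !inE !negb_or /tp1 => /and3P[jA jQ jW]; rewrite !upd_ne.
have := @runs_log_loop g tp1 hd rp tp1A tp1Q b n.-1.
rewrite prednK; last by lia.
move=> R; apply: runs_weaken.
  apply: runs_seq; first exact: runs_count_input.
  rewrite -/tp1; apply: runs_seq; first exact: runs_go_home.
  rewrite ehd; apply: runs_seq; first exact: R.
  have := runs_line (@hg mem) sem (h_move tWE (Some MoveL)) [:: h_write tWE true; h_move tWE None]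
    (HState (set_bi g true None) 0 tp1 (hd3 hd 0 0 (k * up_log 2 n)) rp).
  rewrite [foldl _ _ _]/= !semE /= !hd3E -/s e0 => R'; exact: R'.
by rewrite /=; nia.
Qed.

(** Reading before moving makes the loop run [m] times when the mark is in cell [m - 1]. *)
Definition advance j : prog :=
  While bit_unset
    (line (h_read (tP j)) [:: h_move (tP j) (Some MoveR); h_move (tP j.+1) (Some MoveR)]).

(* Tapes [tP j] and [tP j.+1] represent [m] and [n * m] by a single 1 in the cell
   of index [m - 1], resp. [n * m - 1]. *)
Definition multiply j : prog :=
  Seq (line (h_input tW MoveR) [:: h_sense tW])
 (Seq (While sensed
        (Seq (line (h_mem tW (fun g => set_bi g false (m_i g))) [::])
        (Seq (advance j)
             (line (h_move (tP j) None) [:: h_input tW MoveR; h_sense tW]))))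
 (Seq go_home
      (line (h_move (tP j.+1) (Some MoveL)) [:: h_write (tP j.+1) true; h_move (tP j.+1) None]))).

Fixpoint powers j : prog :=
  if j is j'.+1 then Seq (powers j') (multiply j') else line (h_write (tP 0) true) [::].

Lemma ne_P j : tP j != tP j.+1.
Proof. by rewrite /tP eqn_add2l neq_ltn ltnSn. Qed.

Lemma runs_multiply j m g b i tp hd rp : 0 < m ->
  hd (tP j) = 0 -> hd (tP j.+1) = 0 ->
  (forall p, tp (tP j) p = (p == m.-1)) ->
  exists b', runs (multiply j) (HState (set_bi g b i) 0 tp hd rp)
      (n * (4 * m + 7) + 3 * n + 15)
      (HState (set_bi g b' None) 0
        (upd tp (tP j.+1) (upd (tp (tP j.+1)) (n * m).-1 true)) hd rp).
Proof.
move=> m0 hj hj1 tpj.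
have neP := ne_P j.
have neP' : tP j.+1 != tP j by rewrite eq_sym.
pose hd2 a c := upd (upd hd (tP j) a) (tP j.+1) c.
have hd2j a c : hd2 a c (tP j) = a by rewrite /hd2 (upd_ne _ _ neP) upd_eq.
have hd2j1 a c : hd2 a c (tP j.+1) = c by rewrite /hd2 upd_eq.
have upd2j a c a' : upd (hd2 a c) (tP j) a' = hd2 a' c.
  by rewrite /hd2 (updC _ _ _ neP') upd_upd.
have upd2j1 a c c' : upd (hd2 a c) (tP j.+1) c' = hd2 a c' by rewrite /hd2 upd_upd.
have hd00 : hd2 0 0 = hd by rewrite /hd2 -{1}hj updK -{1}hj1 updK.
have inner ip i1 c : runs (advance j)
    (HState (set_bi g false i1) ip tp (hd2 0 c) rp) (m * 4).+1
    (HState (set_bi g true i1) ip tp (hd2 m (c + m)) rp).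
  pose I d s := d <= m /\ s = HState (set_bi g (d == 0) i1) ip tp (hd2 (m - d) (c + (m - d))) rp.
  have I0 : I m (HState (set_bi g false i1) ip tp (hd2 0 c) rp).
    by rewrite /I subnn addn0 gtn_eqF.
  have [d s [ld ->]|s [_ ->] //|s' R [_ e]] := @runs_while _ _ _ (@hg mem) sem I bit_unset
     (line (h_read (tP j)) [:: h_move (tP j) (Some MoveR); h_move (tP j.+1) (Some MoveR)])
     3 _ _ _ _ I0.
    split=> //; exists (HState (set_bi g (d == 0) i1) ip tp (hd2 (m - d) (c + (m - d))) rp).
      have := runs_line (@hg mem) sem (h_read (tP j))
        [:: h_move (tP j) (Some MoveR); h_move (tP j.+1) (Some MoveR)]
        (HState (set_bi g (d.+1 == 0) i1) ip tp (hd2 (m - d.+1) (c + (m - d.+1))) rp).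
      rewrite [foldl _ _ _]/= !semE /= hd2j upd2j hd2j1 upd2j1 tpj -addnS subnSK //.
      by rewrite (_ : (m - d.+1 == m.-1) = (d == 0)) //; apply/eqP/eqP; lia.
    by split=> //; lia.
  by rewrite e subn0 in R.
pose I d s := exists b', d <= n /\ s = HState (set_bi g b' (input_symbol x (n.+1 - d)))
  (n.+1 - d) tp (hd2 0 ((n - d) * m)) rp.
have I0 : I n (HState (set_bi g b (input_symbol x 1)) 1 tp hd rp).
  by exists b; rewrite subSnn subnn mul0n hd00.
have [d s [b' [ld ->]]|s [b' [_ ->]]|s' R [b' [_ e]]] :=
  @runs_while _ _ _ (@hg mem) sem I sensed
   (Seq (line (h_mem tW (fun g => set_bi g false (m_i g))) [::])
        (Seq (advance j)
             (line (h_move (tP j) None) [:: h_input tW MoveR; h_sense tW]))) (4 * m + 6) _ _ _ _ I0.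
- split; first by rewrite /sensed isSome_input; lia.
  exists (HState (set_bi g true (input_symbol x (n.+1 - d))) (n.+1 - d) tp
    (hd2 0 ((n - d) * m)) rp).
    apply: runs_weaken.
      apply: runs_seq; first exact: runs_line.
      rewrite [foldl _ _ _]/= !semE set_biK; apply: runs_seq; first exact: inner.
      have := runs_line (@hg mem) sem (h_move (tP j) None) [:: h_input tW MoveR; h_sense tW]
        (HState (set_bi g true (input_symbol x (n.+1 - d.+1))) (n.+1 - d.+1) tp
          (hd2 m ((n - d.+1) * m + m)) rp).
      rewrite [foldl _ _ _]/= !semE /= upd2j addnC -mulSn subnSK //.
      rewrite (_ : minn _ _ = n.+1 - d); last by lia.
      by move=> R; exact: R.
    by rewrite /=; lia.
  by exists true; split=> //; lia.
- by rewrite /sensed isSome_input; lia.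
rewrite !subn0 /input_symbol ltnn andbF in e.
exists b'; rewrite e in R; apply: runs_weaken.
  apply: runs_seq; first exact: runs_line.
  rewrite [foldl _ _ _]/= !semE /= set_biK (_ : minn _ _ = 1); last by lia.
  apply: runs_seq; first exact: R.
  apply: runs_seq; first exact: runs_go_home.
  have := runs_line (@hg mem) sem (h_move (tP j.+1) (Some MoveL))
    [:: h_write (tP j.+1) true; h_move (tP j.+1) None]
    (HState (set_bi g b' None) 0 tp (hd2 0 (n * m)) rp).
  rewrite [foldl _ _ _]/= !semE /= !hd2j1 !upd2j1 hd2j1 hd00 => R'; exact: R'.
by rewrite /=; lia.
Qed.

Lemma runs_powers j g b i tp hd rp : 0 < n ->
  (forall l, l <= j -> hd (tP l) = 0 /\ forall p, tp (tP l) p = false) ->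
  exists b' i' tp', [/\ runs (powers j) (HState (set_bi g b i) 0 tp hd rp)
      (j * (n * (4 * n ^ j + 7) + 3 * n + 15) + 1)
      (HState (set_bi g b' i') 0 tp' hd rp),
    forall p, tp' (tP j) p = (p == (n ^ j).-1) &
    forall l, ~~ (tP 0 <= l <= tP j) -> tp' l = tp l].
Proof.
move=> n0; elim: j => [|j IH] blank.
  have [h0 t0] := blank 0 isT.
  exists b, i, (upd tp (tP 0) (upd (tp (tP 0)) 0 true)); split.
  - have := runs_line (@hg mem) sem (h_write (tP 0) true) [::] (HState (set_bi g b i) 0 tp hd rp).
    by rewrite [foldl _ _ _]/= !semE h0.
  - by move=> p; rewrite upd_eq /upd t0 expn0; case: eqP.
  - by move=> l; rewrite -eqn_leq eq_sym => ne; rewrite upd_ne.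
have [l lj|b1 [i1 [tp1 [R1 tpj out]]]] := IH; first by apply: blank; lia.
have [hj _] := blank j (leqnSn _); have [hj1 tj1] := blank j.+1 (leqnn _).
have m0 : 0 < n ^ j by rewrite expn_gt0 n0.
have [b2 R2] := runs_multiply g b1 i1 rp m0 hj hj1 tpj.
exists b2, None; eexists; split.
- apply: runs_weaken (runs_seq R1 R2) _.
  have le : n ^ j <= n ^ j.+1 by rewrite leq_pexp2l.
  have le1 : n * (4 * n ^ j + 7) <= n * (4 * n ^ j.+1 + 7) by rewrite leq_mul2l; lia.
  have : j * (n * (4 * n ^ j + 7) + 3 * n + 15) <= j * (n * (4 * n ^ j.+1 + 7) + 3 * n + 15).
    by rewrite leq_mul2l; lia.
  by rewrite mulSn; lia.
- move=> p; rewrite upd_eq /upd out ?tj1 -?expnS; last by rewrite /tP; lia.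
  by case: eqP.
- move=> l nl; rewrite upd_ne ?out //; first by move: nl; rewrite /tP; lia.
  by apply: contraNneq nl => ->; rewrite /tP leqnn andbT; lia.
Qed.

Definition prepare : prog :=
  Seq go_home (Seq logarithm (powers k)).

Lemma runs_prepare g ip tp hd rp : 1 < n -> ip <= n.+1 ->
  (forall j, B <= j -> hd j = 0 /\ forall p, tp j p = false) ->
  exists b i tp', [/\ runs prepare (HState g ip tp hd rp)
      (up_log 2 n * (10 * n + k + 20) + 10 * n + 24
       + k * (n * (4 * n ^ k + 7) + 3 * n + 15))
      (HState (set_bi g b i) 0 tp' hd rp),
    forall p, tp' tWE p = (p == (k * up_log 2 n).-1),
    forall p, tp' tCE p = (p == (n ^ k).-1) &
    forall j, j \in [:: tW; tC] \/ B + 6 + k <= j -> tp' j = tp j].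
Proof.
move=> n1 lip blank.
have eg : g = set_bi g (m_b g) (m_i g) by case: g.
have [|tp1 R1 [we out1]] := @runs_logarithm g (m_b g) None tp hd rp n1.
  by move=> j; rewrite !inE => /or3P[] /eqP ->; apply: blank; rewrite /tA /tQ /tWE leq_addr.
have [|l _|b [i [tp' [R2 ce out2]]]] := @runs_powers k g true None tp1 hd rp.
- by lia.
- have [|h0 t0] := blank (tP l); first by rewrite /tP -addnA leq_addr.
  by split=> // p; rewrite out1 // !inE /tP /tA /tQ /tWE; lia.
exists b, i, tp'; split=> //.
- apply: runs_weaken (runs_seq _ (runs_seq R1 R2)) _; first by rewrite eg; exact: runs_go_home.
  by lia.
- by move=> p; rewrite out2 ?we // /tP /tWE; lia.
- move=> j; rewrite !inE => lj; rewrite out2; last by move: lj; rewrite /tP /tW /tC; lia.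
  by rewrite out1 // !inE; move: lj; rewrite /tA /tQ /tWE /tW /tC; lia.
Qed.

(** * Simulation of a machine on marked tracks *)

Definition capped (b : bool) (m : move) : move :=
  if m is MoveR then if b then MoveS else MoveR else m.

(** Tracks are unbounded to the right, whereas the simulated heads are clamped; turning a right move
    on the marked last cell into a stay reproduces the clamp. *)
Lemma hmv_capped m p hi : p <= hi -> hmv (Some (capped (p == hi) m)) p = mv m p hi.
Proof. by case: m => //=; case: eqP => [->|] /=; lia. Qed.

Arguments hmv : simpl never.

Definition s_load_work : hatom :=
  HAct tW calm (fun g i w _ =>
    (Memory (m_q g) i w (m_c g) (m_cw g) (m_mw g) (m_mc g) (m_b g) (m_v g) (m_ans g),
     MoveS, (w, Some MoveS))).
Definition s_load_cat : hatom :=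
  HAct tC calm (fun g _ w _ =>
    (Memory (m_q g) (m_i g) (m_w g) w (m_cw g) (m_mw g) (m_mc g) (m_b g) (m_v g) (m_ans g),
     MoveS, (w, Some MoveS))).
(* With [k = 0] the simulated work tape has no cell and always reads 0. *)
Definition s_delta : hatom :=
  HAct tW (fun g => tm_coin M (m_q g) (m_i g) (m_w g) (m_c g))
    (fun g _ _ b =>
      let: (q, mi, (wb, mw), (cw, mc)) := tm_delta M (m_q g) (m_i g) (m_w g) (m_c g) b in
      (Memory q (m_i g) (m_w g) (m_c g) cw mw mc (m_b g) (m_v g) (m_ans g), mi,
       (wb && (0 < k), Some MoveS))).
Definition s_work_end : hatom :=
  HAct tWE calm (fun g _ w _ =>
    (Memory (m_q g) (m_i g) (m_w g) (m_c g) (m_cw g) (capped w (m_mw g)) (m_mc g) (m_b g)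
       (m_v g) (m_ans g), MoveS, (w, Some (capped w (m_mw g))))).
Definition s_work : hatom :=
  HAct tW calm (fun g _ w _ => (g, MoveS, (w, Some (m_mw g)))).
Definition s_cat_end : hatom :=
  HAct tCE calm (fun g _ w _ =>
    (Memory (m_q g) (m_i g) (m_w g) (m_c g) (m_cw g) (m_mw g) (capped w (m_mc g)) (m_b g)
       (m_v g) (m_ans g), MoveS, (w, Some (capped w (m_mc g))))).
Definition s_cat : hatom :=
  HAct tC calm (fun g _ _ _ => (g, MoveS, (m_cw g, Some (m_mc g)))).

(** An atom touches a single track, so one simulated step takes seven atoms. The heads of [tWE] and
    [tCE] follow those of [tW] and [tC]; each pending move is capped on the marker track before it
    is made on the simulated tape. *)
Definition sim_rest := [:: s_load_cat; s_delta; s_work_end; s_work; s_cat_end; s_cat].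

Definition running (g : mem) := tm_halt M (m_q g) == None.

Definition simulate : prog :=
  Seq (line (h_mem tW (fun g => Memory (tm_start M) (m_i g) (m_w g) (m_c g) (m_cw g)
              (m_mw g) (m_mc g) (m_b g) (m_v g) (m_ans g))) [::])
      (While running (line s_load_work sim_rest)).

Definition vote : prog :=
  line (h_mem tW (fun g => Memory (m_q g) (m_i g) (m_w g) (m_c g) (m_cw g)
              (m_mw g) (m_mc g) (m_b g)
              (inord (m_v g + (tm_halt M (m_q g) == Some true))) (m_ans g))) [::].

Definition trial : prog := Seq prepare (Seq simulate vote).

Definition blank_from (b : nat) (h : hstate mem) : Prop :=
  forall j, b <= j -> hhd h j = 0 /\ forall p, htp h j p = false.

Notation s := (k * up_log 2 n).
Notation cc := (n ^ k).

(** [o] is the number of random bits consumed by earlier trials: the simulated machine sees the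
    random tape from there on. *)
Definition simulates (o : nat) (v : 'I_N.+1) (a : option bool) (h : hstate mem)
    (c : config (tm_state M)) : Prop :=
  [/\ [/\ m_q (hg h) = c_st c, m_v (hg h) = v, m_ans (hg h) = a, hip h = c_ip c &
         hrp h = o + c_rp c],
      [/\ hhd h tW = c_wp c, hhd h tWE = c_wp c, hhd h tC = c_cp c & hhd h tCE = c_cp c],
      [/\ c_ip c <= n.+1, c_wp c <= s.-1, c_cp c <= cc.-1, size (c_wt c) = s &
         size (c_ct c) = cc],
      [/\ forall p, htp h tW p = nth false (c_wt c) p,
         forall p, htp h tC p = nth false (c_ct c) p,
         forall p, htp h tWE p = (p == s.-1) & forall p, htp h tCE p = (p == cc.-1)]
    & blank_from (B + 6 + k) h].

Lemma sem_load_work g ip tp hd rp : sem s_load_work (HState g ip tp hd rp) =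
  HState (Memory (m_q g) (input_symbol x ip) (tp tW (hd tW)) (m_c g) (m_cw g) (m_mw g)
            (m_mc g) (m_b g) (m_v g) (m_ans g)) ip tp hd rp.
Proof. by rewrite /hsem /= !updK addn0. Qed.

Lemma sem_load_cat g ip tp hd rp : sem s_load_cat (HState g ip tp hd rp) =
  HState (Memory (m_q g) (m_i g) (m_w g) (tp tC (hd tC)) (m_cw g) (m_mw g)
            (m_mc g) (m_b g) (m_v g) (m_ans g)) ip tp hd rp.
Proof. by rewrite /hsem /= !updK addn0. Qed.

Lemma sem_delta g ip tp hd rp q' mi wb mw cw mc :
  let flip := tm_coin M (m_q g) (m_i g) (m_w g) (m_c g) in
  tm_delta M (m_q g) (m_i g) (m_w g) (m_c g)
    (if flip then Some (nth false r rp) else None) = (q', mi, (wb, mw), (cw, mc)) ->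
  sem s_delta (HState g ip tp hd rp) =
  HState (Memory q' (m_i g) (m_w g) (m_c g) cw mw mc (m_b g) (m_v g) (m_ans g))
    (mv mi ip n.+1) (upd tp tW (upd (tp tW) (hd tW) (wb && (0 < k)))) hd (rp + flip).
Proof. by move=> /= ed; rewrite /hsem /= ed updK. Qed.

Lemma sem_work_end g ip tp hd rp : sem s_work_end (HState g ip tp hd rp) =
  let m := capped (tp tWE (hd tWE)) (m_mw g) in
  HState (Memory (m_q g) (m_i g) (m_w g) (m_c g) (m_cw g) m (m_mc g) (m_b g) (m_v g) (m_ans g))
    ip tp (upd hd tWE (hmv (Some m) (hd tWE))) rp.
Proof. by rewrite /hsem /= !updK addn0. Qed.

Lemma sem_work g ip tp hd rp : sem s_work (HState g ip tp hd rp) =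
  HState g ip tp (upd hd tW (hmv (Some (m_mw g)) (hd tW))) rp.
Proof. by rewrite /hsem /= !updK addn0. Qed.

Lemma sem_cat_end g ip tp hd rp : sem s_cat_end (HState g ip tp hd rp) =
  let m := capped (tp tCE (hd tCE)) (m_mc g) in
  HState (Memory (m_q g) (m_i g) (m_w g) (m_c g) (m_cw g) (m_mw g) m (m_b g) (m_v g) (m_ans g))
    ip tp (upd hd tCE (hmv (Some m) (hd tCE))) rp.
Proof. by rewrite /hsem /= !updK addn0. Qed.

Lemma sem_cat g ip tp hd rp : sem s_cat (HState g ip tp hd rp) =
  HState g ip (upd tp tC (upd (tp tC) (hd tC) (m_cw g)))
    (upd hd tC (hmv (Some (m_mc g)) (hd tC))) rp.
Proof. by rewrite /hsem /= addn0. Qed.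

Lemma mv_le m p hi : p <= hi -> mv m p hi <= hi.
Proof. by case: m => //=; lia. Qed.

Lemma simulates_step o v a h c : 1 < n -> tm_halt M (c_st c) = None ->
  simulates o v a h c ->
  simulates o v a (foldl (fun s a => sem a s) h (s_load_work :: sim_rest))
    (step M x (drop o r) c).
Proof.
case: h => g ip tp hd rp n1 run_c [[/= eq ev ea eip erp] [hW hWE hC hCE]
  [lip lwp lcp sw sc] [tpW tpC tpWE tpCE] blank].
have W_WE : tW != tWE by rewrite /tW /tWE; lia.
have W_C : tW != tC by rewrite /tW /tC; lia.
have W_CE : tW != tCE by rewrite /tW /tCE /tP; lia.
have WE_C : tWE != tC by rewrite /tWE /tC; lia.
have WE_CE : tWE != tCE by rewrite /tWE /tCE /tP; lia.
have C_CE : tC != tCE by rewrite /tC /tCE /tP; lia.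
have C_W : tC != tW by rewrite eq_sym.
have WE_W : tWE != tW by rewrite eq_sym.
have CE_W : tCE != tW by rewrite eq_sym.
have C_WE : tC != tWE by rewrite eq_sym.
have CE_WE : tCE != tWE by rewrite eq_sym.
have CE_C : tCE != tC by rewrite eq_sym.
have cc0 : 0 < cc by rewrite expn_gt0; lia.
rewrite /step run_c -/(input_symbol x (c_ip c)) nth_drop.
set w := nth false (c_wt c) (c_wp c); set cb := nth false (c_ct c) (c_cp c).
set flip := tm_coin _ _ _ _ _; set bit := if flip then _ else _.
case ed: (tm_delta _ _ _ _ _ _) => [[[q' mi] [wb mw]] [cw mc]].
rewrite sem_load_work sem_load_cat /= tpW tpC hW hC -/w -/cb.
rewrite (@sem_delta _ _ _ _ _ q' mi wb mw cw mc); last first.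
  by rewrite /= eq eip erp -/flip -/bit.
rewrite sem_work_end /= sem_work /= sem_cat_end /= sem_cat /=.
rewrite !(upd_eq, upd_ne) // ?tpWE ?tpCE hW hWE hC hCE.
rewrite !hmv_capped //.
split; first by split=> //=; rewrite ?eip // erp /flip ?eq ?addnA.
- by split; rewrite /= !(upd_eq, upd_ne) // ?sw ?sc.
- by split; rewrite /= ?size_write_cell ?sw ?sc ?mv_le.
- split=> p /=; last 2 first.
  + by rewrite !(upd_eq, upd_ne).
  + by rewrite !(upd_eq, upd_ne).
  + rewrite (upd_ne _ _ W_C) upd_eq; case: (posnP k) => [k0|k0].
      have swz : c_wt c = [::] by apply: size0nil; rewrite sw k0.
      rewrite andbF /upd swz /write_cell /= nth_nil tpW swz nth_nil.
      by case: eqP.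
    rewrite andbT /upd tpW nth_write_cell // sw.
    (* This uses [1 < n]: for shorter inputs the logarithm vanishes and the work tape has no
       cell. *)
    have : 0 < s by rewrite muln_gt0 k0 up_log_gt0.
    by lia.
  + by rewrite upd_eq /upd tpC nth_write_cell // sc; lia.
- move=> j lj; have [h0 t0] := blank j lj; move: lj.
  by rewrite /= => lj; rewrite !upd_ne // /tW /tWE /tC /tCE /tP; lia.
Qed.

Lemma runs_simulate o v a h c : 1 < n -> simulates o v a h c ->
  forall t, tm_halt M (c_st (iter t (step M x (drop o r)) c)) != None ->
  exists2 h', runs (While running (line s_load_work sim_rest)) h (t * 8 + 1) h' &
    simulates o v a h' (iter t (step M x (drop o r)) c).
Proof.
move=> n1 sim t; elim: t c h sim => [|t IH] c h sim.
  move=> halt_c; exists h => //; apply: runs_whileF.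
  by rewrite /running; case: sim => -[-> _ _ _ _] _ _ _ _.
rewrite iterSr; case halt_c: (tm_halt M (c_st c)) => [b|].
  (* A simulated machine that has halted is fixed by [step], so the loop may stop before [t]
     iterations. *)
  have -> : step M x (drop o r) c = c by rewrite /step halt_c.
  move=> /(IH _ _ sim) [h' R sim']; exists h' => //.
  by apply: runs_weaken R _; lia.
move=> /(IH _ _ (simulates_step n1 halt_c sim)) [h' R sim']; exists h' => //.
apply: runs_weaken (runs_whileT _ (runs_line _ _ _ _ _) R) _.
  by rewrite /running; case: sim => -[-> _ _ _ _] _ _ _ _; rewrite halt_c.
by rewrite /=; lia.
Qed.

Definition prepare_time := up_log 2 n * (10 * n + k + 20) + 10 * n + 24
       + k * (n * (4 * n ^ k + 7) + 3 * n + 15).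

Lemma runs_trial h t : 1 < n -> hip h <= n.+1 -> blank_from B h -> m_v (hg h) < N ->
  let c := run M x s (nseq cc false) (drop (hrp h) r) t in
  tm_halt M (c_st c) != None ->
  exists2 h', runs trial h (prepare_time + t * 8 + 3) h' &
    [/\ m_v (hg h') = m_v (hg h) + (tm_halt M (c_st c) == Some true) :> nat,
        m_ans (hg h') = m_ans (hg h), hip h' <= n.+1,
        hrp h' = hrp h + c_rp c & blank_from (B + 6 + k) h'].
Proof.
case: h => g ip tp hd rp n1 /= lip blank lv halt_c.
have [b [i [tp1 [R1 we1 ce1 out1]]]] := runs_prepare g rp n1 lip blank.
set c := run _ _ _ _ _ _ in halt_c *.
pose h1 := sem (h_mem tW (fun g => Memory (tm_start M) (m_i g) (m_w g) (m_c g) (m_cw g)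
              (m_mw g) (m_mc g) (m_b g) (m_v g) (m_ans g))) (HState (set_bi g b i) 0 tp1 hd rp).
have blank1 j : B <= j -> hd j = 0 by move=> /blank[].
have sim1 : simulates rp (m_v g) (m_ans g) h1 (init M s (nseq cc false)).
  rewrite /h1 sem_mem; split=> /=.
  - by split=> //; rewrite addn0.
  - by split; apply: blank1; rewrite /tW /tWE /tC /tCE /tP; lia.
  - by split=> //; rewrite size_nseq.
  - split=> // p; rewrite nth_nseq if_same out1 ?inE ?eqxx ?orbT; try by left.
    + by have [|_ ->] := blank tW; rewrite /tW.
    + by have [|_ ->] := blank tC; rewrite /tC; first lia.
  - move=> j lj; rewrite /= out1; last by right.
    by apply: blank; lia.
have [h2 R2 [[eq ev ea eip erp] _ [lip2 _ _ _ _] _ blank2]] := runs_simulate n1 sim1 halt_c.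
rewrite -/c in eq eip erp lip2.
pose h3 := sem (h_mem tW (fun g => Memory (m_q g) (m_i g) (m_w g) (m_c g) (m_cw g)
              (m_mw g) (m_mc g) (m_b g)
              (inord (m_v g + (tm_halt M (m_q g) == Some true))) (m_ans g))) h2.
exists h3.
  apply: runs_weaken.
    apply: runs_seq; first exact: R1.
    apply: runs_seq; last exact: (@runs_line _ _ _ (@hg mem) sem _ [::]).
    apply: runs_seq; last exact: R2.
    exact: (@runs_line _ _ _ (@hg mem) sem _ [::]).
  by rewrite /prepare_time /=; lia.
rewrite /h3; case: h2 eq ev ea eip erp lip2 blank2 {R2 h3} => g2 ip2 tp2 hd2 rp2 /=.
move=> eq ev ea eip erp lip2 blank2; rewrite sem_mem /=; split=> //.
- by rewrite eq ev inordK // ltnS; case: eqP => _; lia.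
- by rewrite eip.
- by rewrite addn0 erp.
Qed.

Lemma tapes_below_line J a l : all (fun a : hatom => h_tape a < J) (a :: l) ->
  tapes_below J (line a l).
Proof.
by elim: l a => [|a' l IH] a /= /andP[la ll]; [|split=> //; apply: IH].
Qed.

Lemma tapes_below_trial J : B + 6 + k <= J -> tapes_below J trial.
Proof.
move=> lJ.
have lW : tW < J by rewrite /tW; lia.
have lWE : tWE < J by rewrite /tWE; lia.
have lC : tC < J by rewrite /tC; lia.
have lA : tA < J by rewrite /tA; lia.
have lQ : tQ < J by rewrite /tQ; lia.
have lP j : j <= k -> tP j < J by rewrite /tP; lia.
have home : tapes_below J go_home by do ![split=> //].
have lCE : tCE < J by apply: lP.
have lpow j : j <= k -> tapes_below J (powers j).
  elim: j => [|j IH] lj; first exact: lP.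
  have lj' := ltnW lj.
  split; first exact: IH.
  by do ![split=> //]; apply: lP.
have lmoves : tapes_below J (line (h_read tA) (nseq k (h_move tWE (Some MoveR)))).
  by apply: tapes_below_line; rewrite /= lA all_nseq /= lWE orbT.
by do ![split=> //]; apply: lpow.
Qed.

End Programs.

Fixpoint trials (m : nat) : prog :=
  if m is m'.+1 then Seq (trials m') (trial (m' * (6 + k)))
  else line (h_move 0 (Some MoveS)) [::].

Lemma tapes_below_trials J m : m * (6 + k) < J -> tapes_below J (trials m).
Proof.
elim: m => [|m IH] lJ; first by rewrite mul0n in lJ.
split; first by apply: IH; rewrite mulSn in lJ; lia.
by apply: tapes_below_trial; rewrite mulSn in lJ; lia.
Qed.

Notation s := (k * up_log 2 n).
Notation cc := (n ^ k).

(** Each trial starts reading the random tape where the previous one stopped; the pair holds this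
    offset and the number of accepting trials. *)
Fixpoint outcome (t m : nat) (o : nat) : nat * nat :=
  if m is m'.+1 then
    let: (o', v) := outcome t m' o in
    let c := run M x s (nseq cc false) (drop o' r) t in
    (o' + c_rp c, v + (tm_halt M (c_st c) == Some true))
  else (o, 0).

Lemma runs_trials g o t m : 1 < n -> m <= N -> m_v g = 0 :> nat ->
  (forall o, tm_halt M (c_st (run M x s (nseq cc false) (drop o r) t)) != None) ->
  exists2 h', runs (trials m) (blank_hstate g o) (m * (prepare_time + t * 8 + 3) + 1) h' &
    [/\ m_v (hg h') = (outcome t m o).2 :> nat, m_ans (hg h') = m_ans g, hip h' <= n.+1,
        hrp h' = (outcome t m o).1 & blank_from (m * (6 + k)) h'].
Proof.
move=> n1 lm v0 halts; elim: m lm => [|m IH] lm.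
  exists (blank_hstate g o); last by [].
  have := runs_line (@hg mem) sem (h_move 0 (Some MoveS)) [::] (blank_hstate g o).
  by rewrite [foldl _ _ _]/= sem_move updK.
have [|h1 R1 [v1 a1 ip1 rp1 blank1]] := IH; first exact: ltnW.
have lv : m_v (hg h1) < N.
  apply: leq_ltn_trans lm; rewrite v1; elim: (m) => //= m' le_v.
  case: (outcome t m' o) le_v => o' v' /=; case: eqP => _ /=; lia.
have halt1 := halts (hrp h1).
have [h2 R2 [v2 a2 ip2 rp2 blank2]] := runs_trial n1 ip1 blank1 lv halt1.
exists h2.
  apply: runs_weaken (runs_seq R1 R2) _; rewrite mulSn; lia.
rewrite /=; case: (outcome t m o) v1 rp1 => o' v' /= v1 rp1; subst o'.
split=> //; [by rewrite v2 v1|by rewrite a2 a1|].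
by move: blank2; rewrite mulSn -addnA addnC.
Qed.

End Trial.

(** * Probability of acceptance and majority vote *)

Section Average.
Variable R : realType.
Local Open Scope ring_scope.

(** The uniform expectation, unfolded from the first bit: the order in which a machine reads its
    random tape. *)
Fixpoint avg (m : nat) (f : seq bool -> R) : R :=
  if m is m'.+1 then
    (avg m' (fun s => f (false :: s)) + avg m' (fun s => f (true :: s))) / 2
  else f [::].

Lemma sum_tuple_cons m (F : seq bool -> R) :
  \sum_(t : m.+1.-tuple bool) F t =
  \sum_(t : m.-tuple bool) F (false :: t) + \sum_(t : m.-tuple bool) F (true :: t).
Proof.
rewrite (reindex (fun p : bool * m.-tuple bool => [tuple of p.1 :: p.2])) /=; last first.
  exists (fun t : m.+1.-tuple bool => (thead t, [tuple of behead t])) => [[b t]|t] _ /=.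
    by rewrite theadE; congr pair; apply/val_inj.
  by apply/val_inj => /=; case/tupleP: t => b t /=; rewrite theadE.
rewrite -(pair_bigA _ (fun b (t : m.-tuple bool) => F (b :: t))) /=.
by rewrite big_bool addrC.
Qed.

Lemma prob_avg m (P : seq bool -> bool) :
  prob (fun r : m.-tuple bool => P r) = avg m (fun s => (P s)%:R) :> R.
Proof.
have -> : prob (fun r : m.-tuple bool => P r) = (\sum_(t : m.-tuple bool) (P t)%:R) / 2 ^+ m :> R.
  rewrite /prob natrX; congr (_ / _); rewrite cardsE -sum1_card natr_sum big_mkcond /=.
  by apply: eq_bigr => t _; rewrite unfold_in; case: (P t).
elim: m P => [|m IH] P.
  rewrite (big_pred1 [tuple]) ?expr0 ?divr1 // => t /=.
  by apply/esym/eqP; rewrite tuple0.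
rewrite (sum_tuple_cons _ (fun s => (P s)%:R)) /= -!IH.
by rewrite exprS invfM -mulrDl mulrA mulrAC.
Qed.

Lemma avg_le m (f g : seq bool -> R) :
  (forall s, size s = m -> f s <= g s) -> avg m f <= avg m g.
Proof.
elim: m f g => [|m IH] f g le_fg /=; first exact: le_fg.
rewrite ler_pM2r ?invr_gt0 // lerD // IH // => s sz; apply: le_fg; by rewrite /= sz.
Qed.

Lemma eq_avg m (f g : seq bool -> R) :
  (forall s, size s = m -> f s = g s) -> avg m f = avg m g.
Proof.
by move=> e; apply/le_anti/andP; split; apply: avg_le => s sz; rewrite e.
Qed.

Lemma avg_const m c : avg m (fun _ => c) = c.
Proof. by elim: m => //= m ->; field. Qed.

Lemma avg_affine m a b f : avg m (fun s => a * f s + b) = a * avg m f + b.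
Proof. by elim: m f => //= m IH f; rewrite !IH; field. Qed.

End Average.

(** With [g] right and [b] wrong votes, the accepting ones number [g] or [b] according to [L]. A tie
    rejects, hence is wrong when [L] holds, and only the weak inequality follows. *)
Lemma wrong_majority (L : bool) g b :
  (g + b < 2 * (if L then g else b)) != L -> g <= b.
Proof. by case: L => /=; lia. Qed.

(** * Dependence of a run on its random bits *)

Section Machine.
Variables (M : TM) (x : seq bool).
Notation conf := (config (tm_state M)).
Notation step := (step M x).

Definition flips (c : conf) : bool :=
  (tm_halt M (c_st c) == None) &&
  tm_coin M (c_st c) (input_symbol x (c_ip c))
    (nth false (c_wt c) (c_wp c)) (nth false (c_ct c) (c_cp c)).

Lemma c_rp_step r c : c_rp (step r c) = c_rp c + flips c.
Proof.
rewrite /step /Defs.step /flips; case: (tm_halt _ _) => [b|] /=; first by rewrite addn0.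
by case: (tm_delta _ _ _ _ _ _) => [[[q mi] [wb mw]] [cb mc]].
Qed.

Lemma step_ext r r' c : (flips c -> nth false r (c_rp c) = nth false r' (c_rp c)) ->
  step r c = step r' c.
Proof.
rewrite /step /Defs.step /flips; case: (tm_halt _ _) => [b|] //=.
by rewrite -/(input_symbol x (c_ip c)); case: (tm_coin _ _ _ _ _) => // ->.
Qed.

Lemma c_rp_iter r c t : c_rp c <= c_rp (iter t (step r) c) <= c_rp c + t.
Proof.
elim: t => [|t /andP[IH1 IH2]]; first by rewrite addn0 leqnn.
by rewrite iterS c_rp_step; case: flips => /=; lia.
Qed.

Lemma iter_step_ext r r' c t :
  (forall i, c_rp c <= i < c_rp c + t -> nth false r i = nth false r' i) ->
  iter t (step r) c = iter t (step r') c.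
Proof.
elim: t => //= t IH e; rewrite -IH; last by move=> i li; apply: e; lia.
by apply: step_ext => _; apply: e; have := c_rp_iter r c t; lia.
Qed.

Lemma iter_step_halt r c t t' : t <= t' -> tm_halt M (c_st (iter t (step r) c)) != None ->
  iter t' (step r) c = iter t (step r) c.
Proof.
move=> /subnK <-; elim: (t' - t) => //= d IH h.
by rewrite IH // /Defs.step; case: (tm_halt _ _) h.
Qed.

Section Expectation.
Variable R : realType.
Local Open Scope ring_scope.

Definition toss (b : bool) (c : conf) : conf := step (nseq (c_rp c) false ++ [:: b]) c.

(** The expectation over the computation tree, which branches only where the machine really consumes
    a bit. It makes no reference to the length of the random tape. *)
Fixpoint ev (t : nat) (c : conf) (Psi : conf -> R) : R :=
  if t is t'.+1 then
    if flips c then (ev t' (toss false c) Psi + ev t' (toss true c) Psi) / 2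
    else ev t' (toss false c) Psi
  else Psi c.

Lemma ev_le t c (f g : conf -> R) :
  (forall c', (c_rp c <= c_rp c' <= c_rp c + t)%N -> f c' <= g c') -> ev t c f <= ev t c g.
Proof.
elim: t c => [|t IH] c le_fg /=; first by apply: le_fg; rewrite addn0 leqnn.
have h b : ev t (toss b c) f <= ev t (toss b c) g.
  apply: IH => c'; rewrite c_rp_step => lc; apply: le_fg; move: lc; case: flips => /=; lia.
by case: ifP => _ //; rewrite ler_pM2r ?invr_gt0 // lerD.
Qed.

Lemma eq_ev t c (f g : conf -> R) :
  (forall c', (c_rp c <= c_rp c' <= c_rp c + t)%N -> f c' = g c') -> ev t c f = ev t c g.
Proof.
by move=> e; apply/le_anti/andP; split; apply: ev_le => c' lc; rewrite e.
Qed.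

Lemma ev_affine t c a b (f : conf -> R) :
  ev t c (fun c' => a * f c' + b) = a * ev t c f + b.
Proof.
by elim: t c => //= t IH c; rewrite !IH; case: ifP => // _; field.
Qed.

(** Since the random tape is read once, the suffix left unread after [t] steps is uniform given the
    configuration reached. This is the independence of successive trials. The prefix of zeros stands
    for the bits already read, whose values can no longer matter. *)
Lemma avg_run t m c (Phi : conf -> seq bool -> R) : (t <= m)%N ->
  avg m (fun s => let r := nseq (c_rp c) false ++ s in
                  let c' := iter t (step r) c in Phi c' (drop (c_rp c') r)) =
  ev t c (fun c' => avg (m - (c_rp c' - c_rp c)) (Phi c')).
Proof.
elim: t m c => [|t IH] m c ltm.
  rewrite /= subnn subn0; apply: eq_avg => s _.
  by rewrite drop_size_cat ?size_nseq.
rewrite [RHS]/=; case: ifP => fl.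
  case: m ltm => // m ltm; rewrite [LHS]/=.
  have h b : avg m (fun s => let r := nseq (c_rp c) false ++ b :: s in
      let c' := iter t.+1 (step r) c in Phi c' (drop (c_rp c') r)) =
    ev t (toss b c) (fun c' => avg (m.+1 - (c_rp c' - c_rp c)) (Phi c')).
    have rp1 : c_rp (toss b c) = (c_rp c).+1 by rewrite c_rp_step fl addn1.
    rewrite (eq_ev (g := fun c' => avg (m - (c_rp c' - c_rp (toss b c))) (Phi c'))); last first.
      by move=> c'; rewrite rp1 => lc; congr avg; lia.
    rewrite -IH //; apply: eq_avg => s _ /=.
    rewrite -iterS iterSr.
    have -> : step (nseq (c_rp c) false ++ b :: s) c = toss b c.
      by apply: step_ext => _; rewrite !nth_cat size_nseq ltnn subnn.
    (* The two tapes differ at most in cell [c_rp c], which has just been read. *)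
    set r1 := nseq (c_rp c) false ++ _; set r2 := nseq (c_rp (toss b c)) false ++ _.
    have er i : (c_rp (toss b c) <= i)%N -> nth false r1 i = nth false r2 i.
      rewrite rp1 => li; rewrite !nth_cat !size_nseq rp1 ltnNge (ltnW li) ltnNge li /=.
      by rewrite (_ : (i - c_rp c)%N = (i - (c_rp c).+1).+1) //; lia.
    have -> : iter t (step r1) (toss b c) = iter t (step r2) (toss b c).
      by apply: iter_step_ext => i /andP[li _]; apply: er.
    congr Phi; set c' := iter t _ _.
    have lc : (c_rp (toss b c) <= c_rp c')%N by case/andP: (c_rp_iter r2 (toss b c) t).
    have sz : size r1 = size r2 by rewrite !size_cat !size_nseq rp1 /=; lia.
    apply: (@eq_from_nth _ false) => [|i _]; first by rewrite !size_drop sz.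
    by rewrite !nth_drop er //; lia.
  by rewrite !h.
have rp1 : c_rp (toss false c) = c_rp c by rewrite c_rp_step fl addn0.
rewrite -{2}rp1 -IH; last exact: ltnW.
apply: eq_avg => s _ /=; rewrite -iterS iterSr rp1.
have -> : step (nseq (c_rp c) false ++ s) c = toss false c by apply: step_ext; rewrite fl.
by [].
Qed.

End Expectation.

(** * Error of the majority vote *)

Section Amplify.
Variables (s : nat) (tau : seq bool) (T N : nat) (L : bool).
Notation start := (Defs.init M s tau).
Notation good c := (tm_halt M (c_st c) == Some L).
Hypothesis halts : forall r, tm_halt M (c_st (run M x s tau r T)) != None.

Fixpoint votes (j : nat) (r : seq bool) : nat :=
  if j is j'.+1 then
    let c := run M x s tau r T in
    (tm_halt M (c_st c) == Some true) + votes j' (drop (c_rp c) r)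
  else 0.

Section Bound.
Variable R : realType.
Local Open Scope ring_scope.
Variables (p0 alpha : R).
Hypothesis alpha0 : 0 < alpha.
Hypothesis alpha1 : alpha <= 1.
Hypothesis p0_ge0 : 0 <= p0.
Hypothesis good_prob : p0 <= ev T start (fun c => (good c)%:R).
Let beta := p0 * alpha + (1 - p0) / alpha.

(* [alpha ^ (correct - wrong)] drops by a factor [beta] per trial in expectation, and
   is at least 1 when the majority is wrong. *)
Lemma votes_wrong j m g b : (j * T <= m)%N -> (g + b + j = N)%N ->
  avg m (fun r => ((N < 2 * ((if L then g else b) + votes j r))%N != L)%:R) <=
  beta ^+ j * alpha ^+ g / alpha ^+ b.
Proof.
have inv1 : 1 <= alpha^-1 by rewrite -[1]invr1 lef_pV2 // posrE.
pose p := ev T start (fun c => (good c)%:R : R).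
have good_p : p0 <= p by exact: good_prob.
have p_le1 : p <= 1.
  apply: le_trans (ev_le (g := fun=> 0 * 0 + 1) _) _ => [c _|].
    by rewrite mul0r add0r lern1 leq_b1.
  by rewrite (ev_affine T start 0 1 (fun=> 0)) mul0r add0r.
(* As [alpha <= alpha^-1], the growth factor decreases in the success probability, so the lower
   bound [p0] may replace the true value [p]. *)
have rate : alpha * p + alpha^-1 * (1 - p) <= beta.
  have : 0 <= (p - p0) * (alpha^-1 - alpha).
    by rewrite mulr_ge0 ?subr_ge0 // (le_trans alpha1).
  by rewrite /beta; set i := alpha^-1; nra.
have beta0 : 0 <= beta.
  apply: le_trans rate; rewrite addr_ge0 ?mulr_ge0 ?subr_ge0 ?invr_ge0 ?(ltW alpha0) //.
  exact: le_trans good_p.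
(* [g] and [b] count the right and wrong trials already made, and [if L then g else b] the accepting
   ones among them; [j] trials remain. *)
elim: j m g b => [|j IH] m g b ltm eN.
  rewrite (eq_avg (g := fun=> ((N < 2 * (if L then g else b))%N != L)%:R)) ?avg_const;
    last by move=> r _; rewrite /= addn0.
  case wrong: (_ != L); last by rewrite !mulr_ge0 ?invr_ge0 ?exprn_ge0 ?(ltW alpha0).
  have le_gb : (g <= b)%N by move: wrong; rewrite -eN addn0 => /wrong_majority.
  rewrite expr0 mul1r -(subnK le_gb) exprD invfM mulrCA mulfV ?mulr1; last first.
    by rewrite expf_neq0 // gt_eqF.
  by rewrite -exprVn exprn_ege1.
have ltm' : (T <= m)%N by apply: leq_trans ltm; rewrite mulSn leq_addr.
pose W v : R := ((N < 2 * v)%N != L)%:R.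
pose Phi (c : conf) r := W ((if L then g else b) + ((good c == L) + votes j r))%N.
(* Condition on the configuration ending the first remaining trial: the other trials then average
   over the unread bits alone. *)
have -> : avg m (fun r => W ((if L then g else b) + votes j.+1 r)%N) =
    ev T start (fun c => avg (m - (c_rp c - 0)) (Phi c)).
  rewrite -(@avg_run R T m start Phi ltm'); apply: eq_avg => r _ /=.
  rewrite /Phi -/(run M x s tau r T); set c := run _ _ _ _ _ _.
  rewrite -/(run M x s tau r T) -/c; congr (W (_ + (nat_of_bool _ + _)))%N.
  have := halts r; rewrite -/c; case: (tm_halt _ _) => [[]|] // _; by case: (L).
pose A := beta ^+ j * alpha ^+ g / alpha ^+ b.
have A0 : 0 <= A by rewrite !mulr_ge0 ?invr_ge0 ?exprn_ge0 ?(ltW alpha0).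
have an0 : alpha != 0 by rewrite gt_eqF.
(* A right trial multiplies the bound by [alpha], a wrong one divides it by [alpha]; both cases are
   written as one affine function of the indicator, as [ev_affine] expects. *)
apply: (@le_trans _ _ (ev T start (fun c => A * (alpha - alpha^-1) * (good c)%:R + A / alpha))).
  apply: ev_le => c /andP[_ lc]; rewrite subn0.
  have lm : (j * T <= m - c_rp c)%N.
    by rewrite leq_subRL ?(leq_trans lc) //; apply: leq_trans ltm; rewrite mulSn leq_add2r.
  rewrite /Phi; case: (good c) => /=.
    rewrite mulr1 mulrBr subrK.
    rewrite (_ : A * alpha = beta ^+ j * alpha ^+ g.+1 / alpha ^+ b); last first.
      by rewrite /A exprS; ring.
    have e : (g.+1 + b + j = N)%N by rewrite -eN !addSn addnS.
    apply: le_trans (IH _ _ _ lm e); apply: avg_le => r _; rewrite /W.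
    by case: (L) => /=; rewrite ?add0n // addnA addn1.
  rewrite mulr0 add0r.
  rewrite (_ : A / alpha = beta ^+ j * alpha ^+ g / alpha ^+ b.+1); last first.
    by rewrite /A exprS invfM; ring.
  have e : (g + b.+1 + j = N)%N by rewrite -eN addnS addSn addnS.
  apply: le_trans (IH _ _ _ lm e); apply: avg_le => r _; rewrite /W.
  by case: (L) => /=; rewrite ?add0n // addnA addn1.
rewrite ev_affine -/p exprS.
rewrite [leRHS](_ : _ = A * beta); last by rewrite /A; ring.
apply: le_trans (ler_wpM2l A0 rate); rewrite le_eqVlt; apply/orP; left.
by apply/eqP; ring.
Qed.

End Bound.
End Amplify.
End Machine.

(** * The common program *)

Section TopLevel.
Variables (M : TM) (k N b a : nat) (L : language).
Notation mem := (memory (tm_state M) N).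
Notation F := (mem * bool * option move)%type.
Notation prog := (cmd (atom F) F).
Notation J := (N * (6 + k) + 1).

Definition set_ans (g : mem) (ans : option bool) : mem :=
  Memory (m_q g) (m_i g) (m_w g) (m_c g) (m_cw g) (m_mw g) (m_mc g) (m_b g) (m_v g) ans.
Definition answer (f : F) (v : bool) : F := (set_ans f.1.1 (Some v), f.1.2, f.2).
Definition put (f : F) (v : bool) : F := (f.1.1, v, f.2).
Definition answered (f : F) : bool := isSome (m_ans f.1.1).

Definition peek (m : move) (upd_mem : F -> option bool -> F) : atom F :=
  Act (fun _ => false) (fun f i w _ => (upd_mem f i, m, (w, MoveS))).
Definition toss_coin (upd_mem : F -> bool -> F) : atom F :=
  Act (fun _ => true) (fun f _ w c => (upd_mem f (odflt false c), MoveS, (w, MoveS))).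

(** The input head visits cells 1 and 2 and returns. [L] enters the transition table only through
    its three values on inputs of length 0 and 1. *)
Definition probe : prog :=
  line (peek MoveR (fun f _ => f))
    [:: peek MoveR (fun f i => if i is Some v then put f v else answer f (L [::]));
        peek MoveL (fun f i => if answered f || isSome i then f else answer f (L [:: scratch f]));
        peek MoveL (fun f _ => f)].

(* Sets the scratch bit with probability [a / 2 ^ b], by recursive bisection. *)
Fixpoint bias (b a : nat) : prog :=
  if b is b'.+1 then
    Seq (Atom (toss_coin put)) (Ite (@scratch _) (bias b' a./2) (bias b' (uphalf a)))
  else Atom (peek MoveS (fun f _ => put f (0 < a))).

Fixpoint bias_out (b a : nat) (r : seq bool) : bool :=
  if b is b'.+1 then bias_out b' (if head false r then a./2 else uphalf a) (behead r)
  else 0 < a.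

Definition simulation : prog := Seq (setup mem J) (lower J (trials M k N N)).

(** The biased coin is tossed in the finite control before any cell is changed; the tape is altered
    only inside [simulation]. *)
Definition top : prog :=
  Seq probe
    (Ite answered (Atom noop)
      (Seq (bias b a) (Ite (@scratch _) simulation (Atom (toss_coin answer))))).

Definition out (f : F) : bool := odflt (N < 2 * m_v f.1.1) (m_ans f.1.1).

Definition mem0 : mem := Memory (tm_start M) None false false false MoveS MoveS false ord0 None.
Definition f0 : F := (mem0, false, None).

Variables x r : seq bool.
Notation n := (size x).
Notation sem := (tsem x r).
Notation runs := (runs (@t_mem F) sem).

Lemma sem_peek m u f ip t p rp : sem (peek m u) (TState f ip t p rp) =
  TState (u f (input_symbol x ip)) (mv m ip n.+1) t p rp.
Proof. by rewrite /tsem /= write_cell_id addn0. Qed.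

Lemma sem_toss u f ip t p rp : sem (toss_coin u) (TState f ip t p rp) =
  TState (u f (nth false r rp)) ip t p rp.+1.
Proof. by rewrite /tsem /= write_cell_id addn1. Qed.

Lemma runs_bias f ip t rp (c d : nat) :
  runs (bias c d) (TState f ip t 0 rp) (2 * c + 1)
    (TState (put f (bias_out c d (drop rp r))) ip t 0 (rp + c)).
Proof.
elim: c d rp f => [|c IH] d rp f.
  by have := runs_atom (@t_mem F) sem (peek MoveS (fun f _ => put f (0 < d))) (TState f ip t 0 rp);
    rewrite sem_peek addn0.
have := runs_atom (@t_mem F) sem (toss_coin put) (TState f ip t 0 rp).
rewrite sem_toss -(addSnnS rp) => R1.
have e0 : head false (drop rp r) = nth false r rp by rewrite -nth0 nth_drop addn0.
have e1 : behead (drop rp r) = drop rp.+1 r by rewrite -drop1 drop_drop add1n.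
rewrite (_ : 2 * c.+1 + 1 = 1 + (2 * c + 1).+1); last by lia.
rewrite [bias _ _]/= [bias_out _ _ _]/= e0 e1.
apply: runs_seq R1 _; case: (nth false r rp).
  by apply: runs_iteT => //; exact: (IH _ _ (put f true)).
by apply: runs_iteF => //; exact: (IH _ _ (put f false)).
Qed.

Lemma probe_small t : n <= 1 -> exists2 s', runs probe (TState f0 0 t 0 0) 4 s' &
  t_tape s' = t /\ m_ans (t_mem s').1.1 = Some (L x).
Proof.
move=> n1; have R := runs_line (@t_mem F) sem (peek MoveR (fun f _ => f))
    [:: peek MoveR (fun f i => if i is Some v then put f v else answer f (L [::]));
        peek MoveL (fun f i => if answered f || isSome i then f else answer f (L [:: scratch f]));
        peek MoveL (fun f _ => f)] (TState f0 0 t 0 0).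
eexists; first exact: R.
rewrite [foldl _ _ _]/= !sem_peek.
by clear R; case: x n1 => [|v [|]].
Qed.

Lemma probe_large t : 1 < n -> exists v,
  runs probe (TState f0 0 t 0 0) 4 (TState (put f0 v) 0 t 0 0).
Proof.
move=> n1; have R := runs_line (@t_mem F) sem (peek MoveR (fun f _ => f))
    [:: peek MoveR (fun f i => if i is Some v then put f v else answer f (L [::]));
        peek MoveL (fun f i => if answered f || isSome i then f else answer f (L [:: scratch f]));
        peek MoveL (fun f _ => f)] (TState f0 0 t 0 0).
exists (nth false x 0); move: R.
rewrite [foldl _ _ _]/= !sem_peek.
by case: x n1 => [|v [|v' l]] // _ R; exact: R.
Qed.


Lemma top_small t : n <= 1 -> exists2 s', runs top (TState f0 0 t 0 0) 6 s' &
  t_tape s' = t /\ out (t_mem s') = L x.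
Proof.
move=> n1; have [s' R [et ea]] := probe_small t n1.
exists s'; last by rewrite /out ea.
have R1 := runs_atom (@t_mem F) sem noop s'; rewrite sem_noop in R1.
have aT : answered (t_mem s') by rewrite /answered ea.
exact: runs_seq R (runs_iteT _ aT R1).
Qed.

Lemma top_random t : 1 < n -> ~~ bias_out b a r ->
  exists2 s', runs top (TState f0 0 t 0 0) (2 * b + 8) s' &
  t_tape s' = t /\ out (t_mem s') = nth false r b.
Proof.
move=> n1 bF; have [v R1] := probe_large t n1.
have R2 := runs_bias (put f0 v) 0 t 0 b a.
rewrite drop0 add0n (negbTE bF) in R2.
have R3 := runs_atom (@t_mem F) sem (toss_coin answer) (TState (put f0 false) 0 t 0 b).
rewrite sem_toss in R3.
exists (TState (answer (put f0 false) (nth false r b)) 0 t 0 b.+1) => //.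
apply: runs_weaken.
  apply: runs_seq R1 _; apply: runs_iteF => //; apply: runs_seq R2 _.
  by apply: runs_iteF => //; exact: R3.
by lia.
Qed.

Notation s := (k * up_log 2 n).
Notation cc := (n ^ k).
Notation K := (width J).

Variable T : nat.
Hypothesis halts :
  forall r, tm_halt M (c_st (run M x s (nseq cc false) r T)) != None.

Definition trials_time := N * (prepare_time k x + T * 8 + 3) + 1.
(** The first terms pay for the probe, the coins and the setup, the product for the quadratic cost
    of lowering. The same number serves as a space bound, since the frontier cannot outrun the
    clock. *)
Definition simulation_time :=
  2 * b + 9 + 2 * K + trials_time * (20 * (K + 3) * (trials_time + 2)).

(** The program appends trials at the end, whereas averaging peels them off at the front; this
    identity passes from [outcome] to [votes]. *)
Lemma outcomeS m o : outcome M k x r T m.+1 o =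
  let c := run M x s (nseq cc false) (drop o r) T in
  let: (o', v) := outcome M k x r T m (o + c_rp c) in
  (o', (tm_halt M (c_st c) == Some true) + v).
Proof.
elim: m o => [|m IH] o; first by rewrite /= addn0.
rewrite [LHS]/= -/(outcome M k x r T m.+1 o) IH /=.
by case: (outcome _ _ _ _ _ m _) => o' v; rewrite addnA.
Qed.

Lemma outcome_votes m o : (outcome M k x r T m o).2 =
  votes M x s (nseq cc false) T m (drop o r).
Proof.
elim: m o => // m IH o; rewrite outcomeS /=.
rewrite drop_drop -IH [c_rp _ + o]addnC.
by case: (outcome _ _ _ _ _ _ _).
Qed.

Lemma top_main t : 1 < n -> bias_out b a r -> simulation_time < size t ->
  exists2 s', runs top (TState f0 0 t 0 0) simulation_time s' &
  out (t_mem s') = (N < 2 * votes M x s (nseq cc false) T N (drop b r)).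
Proof.
move=> n1 bT lt; have [v R1] := probe_large t n1.
have R2 := runs_bias (put f0 v) 0 t 0 b a.
rewrite drop0 add0n bT in R2.
have lK : K < size t by move: lt; rewrite /simulation_time; lia.
have [s3 R3 [rep3 sz3]] := runs_setup (J := J) x r (put f0 true : F) b lK.
have [h [l le_l R4]  [v4 a4 _ _ _]] := runs_trials (N := N) (r := r) (g := mem0) b n1 (leqnn N)
  (erefl _) (fun o => halts (drop o r)).
have Jok : N * (6 + k) < J by rewrite addn1.
have le_size : K * (0 + l + 2) <= size (t_tape s3).
  rewrite sz3; apply: leq_trans (ltnW lt); rewrite /simulation_time.
  have : K * (0 + l + 2) <= K * (trials_time + 2).
    by rewrite leq_mul2l; apply/orP; right; rewrite leq_add2r add0n.
  have : 0 < trials_time by rewrite /trials_time addn1.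
  move: (trials_time) (K) => H w H0; nia.
have [s5 [top5 [R5 [[e5 _ _ _] _ _ _] _ _]]] :=
  runs_lower R4 (@tapes_below_trials M k N J N Jok) rep3 le_size.
exists s5.
  apply: runs_weaken.
    apply: runs_seq R1 _; apply: runs_iteF => //; apply: runs_seq R2 _.
    by apply: runs_iteT => //; apply: runs_seq R3 R5.
  have : l * (20 * (K + 3) * (0 + l + 2)) <= trials_time * (20 * (K + 3) * (trials_time + 2)).
    by rewrite leq_mul // leq_mul2l add0n leq_add2r le_l orbT.
  by rewrite /simulation_time; move: (l * _) (trials_time * _) => X Y; lia.
by rewrite /out e5 a4 /= v4 outcome_votes.
Qed.

End TopLevel.

(** * Polynomial bounds and the two inclusions *)

(** For [1 < n] a pure power absorbs constants, and a pure power is what the catalytic tape offers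
    as its length. *)
Definition poly_bounded (f : nat -> nat) : Prop :=
  exists k, forall n, 1 < n -> f n <= n ^ k.

Lemma poly_const c : poly_bounded (fun _ => c).
Proof.
exists c => n n1; apply: leq_trans (ltnW (ltn_expl c n1)) _.
by [].
Qed.

Lemma poly_id : poly_bounded id.
Proof. by exists 1 => n _; rewrite expn1. Qed.

Lemma poly_exp k : poly_bounded (fun n => n ^ k).
Proof. by exists k. Qed.

Lemma poly_add f g : poly_bounded f -> poly_bounded g ->
  poly_bounded (fun n => f n + g n).
Proof.
move=> [k1 b1] [k2 b2]; exists (maxn k1 k2).+1 => n n1.
apply: (@leq_trans (2 * n ^ maxn k1 k2)); last by rewrite expnS leq_mul2r n1 orbT.
rewrite mul2n -addnn leq_add //.
  by apply: leq_trans (b1 n n1) _; rewrite leq_exp2l // leq_maxl.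
by apply: leq_trans (b2 n n1) _; rewrite leq_exp2l // leq_maxr.
Qed.

Lemma poly_mul f g : poly_bounded f -> poly_bounded g ->
  poly_bounded (fun n => f n * g n).
Proof.
by move=> [k1 b1] [k2 b2]; exists (k1 + k2) => n n1; rewrite expnD leq_mul ?b1 ?b2.
Qed.

Lemma poly_log : poly_bounded (up_log 2).
Proof.
by exists 1 => n n1; rewrite expn1; apply: up_log_min => //; apply/ltnW/ltn_expl.
Qed.

Lemma poly_simulation_time k N b : exists k', forall x : seq bool, 1 < size x ->
  simulation_time k N b x (tbound k (size x)) < size x ^ k'.
Proof.
pose trial n := up_log 2 n * (10 * n + k + 20) + 10 * n + 24
  + k * (n * (4 * n ^ k + 7) + 3 * n + 15) + (n ^ k + k) * 8 + 3.
pose W := width (N * (6 + k) + 1).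
have polyT : poly_bounded (fun n => N * trial n + 1).
  by do ![exact: poly_const|exact: poly_id|exact: poly_log|exact: poly_exp
         |apply: poly_add|apply: poly_mul].
have [k' bound] : poly_bounded (fun n =>
    2 * b + 9 + 2 * W + (N * trial n + 1) * (20 * (W + 3) * (N * trial n + 1 + 2)) + 1).
  by do ![exact: polyT|exact: poly_const|apply: poly_add|apply: poly_mul].
by exists k' => x n1; move: (bound _ n1); rewrite addn1.
Qed.

Lemma poly_random_bits k N b : exists k', forall n, 1 < n ->
  b + (N * tbound k n).+1 <= n ^ k'.
Proof.
have [k' bound] : poly_bounded (fun n => b + (N * (n ^ k + k) + 1)).
  by do ![exact: poly_const|exact: poly_exp|apply: poly_add|apply: poly_mul].
by exists k' => n /bound; rewrite addn1.
Qed.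

Section CatalyticCopy.
Variable M : TM.

(** The work tape of a BPP machine is too long for logarithmic space, so its role passes to the
    catalytic tape. The machine's own catalytic tape is empty and always reads [false]. *)
Definition on_catalytic_tape : TM :=
  {| tm_state := tm_state M;
     tm_start := tm_start M;
     tm_halt := tm_halt M;
     tm_coin := fun q i _ cb => tm_coin M q i cb false;
     tm_delta := fun q i w cb b =>
       let: (q', mi, wm, _) := tm_delta M q i cb false b in (q', mi, (w, MoveS), wm) |}.

(* Within [T] steps a head started at cell 0 never feels the right end of a
   tape of [T] cells, except possibly when its last move is discarded. *)
Lemma run_on_catalytic_tape x s cc r T : T < cc ->
  c_st (run on_catalytic_tape x s (nseq cc false) r T) = c_st (run M x T [::] r T).
Proof.
move=> lT.
suff H : forall t, t <= T ->
  let c := run M x T [::] r t in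
  let c' := run on_catalytic_tape x s (nseq cc false) r t in
  [/\ [/\ c_st c' = c_st c, c_ip c' = c_ip c & c_rp c' = c_rp c],
    [/\ size (c_wt c) = T, size (c_ct c') = cc & c_ct c = [::]],
    forall i, nth false (c_ct c') i = nth false (c_wt c) i &
    t < T -> c_cp c' = c_wp c /\ c_wp c <= t].
  by have [[]] := H T (leqnn T).
elim=> [|t IH] lt.
  split=> //=; first by rewrite !size_nseq.
  by move=> i; rewrite !nth_nseq !if_same.
have [[est eip erp] [sw sc ec] tp /(_ lt) [ecp lp]] := IH (ltnW lt).
rewrite /run !iterS -/(run M x T [::] r t) -/(run on_catalytic_tape x s (nseq cc false) r t).
move: (run M _ _ _ _ _) (run _ _ _ _ _ _) est eip erp sw sc ec tp ecp lp => c c'.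
case: c => q ip wt wp ct cp rp; case: c' => q' ip' wt' wp' ct' cp' rp' /=.
move=> -> -> -> sw sc -> tp -> lp; rewrite /step /=.
case: (tm_halt M q) => [v|] /=; first by split=> // lt'; split=> //; apply: leqW.
rewrite tp nth_nil; set bit := if _ then _ else _.
case: (tm_delta _ _ _ _ _ _) => [[[q2 mi] [wb mw]] [cb mc]] /=.
split=> //.
- by rewrite !size_write_cell; split=> //; rewrite /write_cell.
- by move=> i; rewrite !nth_write_cell ?sw ?sc ?tp //; lia.
- by move=> lt'; rewrite sw sc; case: (mw) => /=; split=> //; lia.
Qed.

End CatalyticCopy.

Section Acceptance.
Variable R : realType.
Local Open Scope ring_scope.

Lemma avg_run_start M x s tau T m (G : config (tm_state M) -> bool) : (T <= m)%N ->
  avg m (fun r => (G (run M x s tau r T))%:R) =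
  ev x T (Defs.init M s tau) (fun c => (G c)%:R) :> R.
Proof.
move=> lT; have -> := @avg_run M x R T m (Defs.init M s tau) (fun c _ => (G c)%:R) lT.
by apply: eq_ev => c _; rewrite avg_const.
Qed.

(** Only the first [T] random bits can be read in [T] steps, so any string may be cut or padded to
    length [m]. *)
Lemma halts_any M x s tau T m :
  (forall r : m.-tuple bool, tm_halt M (c_st (run M x s tau r T)) != None) ->
  (T <= m)%N -> forall r, tm_halt M (c_st (run M x s tau r T)) != None.
Proof.
move=> H lT r; have := H [tuple of mkseq (nth false r) m].
rewrite (_ : run M x s tau r T = run M x s tau [tuple of mkseq (nth false r) m] T) //.
by apply: iter_step_ext => i /andP[_ li]; rewrite nth_mkseq // (leq_trans li).
Qed.

Lemma halves a : (uphalf a + a./2)%N = a.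
Proof. by rewrite uphalf_half -addnA addnn odd_double_half. Qed.

(** The two subtrees get numerators [a./2] and [uphalf a], whose sum is [a]; whichever branch is
    taken then reads fresh bits. *)
Lemma avg_bias b a m (f g : seq bool -> R) : (a <= 2 ^ b)%N ->
  avg (b + m) (fun r => if bias_out b a r then f (drop b r) else g (drop b r)) =
  (a%:R / 2 ^+ b) * avg m f + (1 - a%:R / 2 ^+ b) * avg m g.
Proof.
elim: b a => [|b IH] a la.
  rewrite /= expr0 divr1; case: a la => [|[|a]] //= _.
    by rewrite mul0r subr0 mul1r add0r; apply: eq_avg => s _; rewrite drop0.
  by rewrite subrr mul0r mul1r addr0; apply: eq_avg => s _; rewrite drop0.
rewrite addSn /= !IH; [|by rewrite expnS in la; lia|by rewrite expnS in la; lia].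
have -> : (a%:R : R) = (uphalf a)%:R + (a./2)%:R by rewrite -natrD halves.
have : (2 ^+ b : R) != 0 by rewrite expf_neq0 ?pnatr_eq0.
by rewrite exprS; move: (2 ^+ b) => c c0; field.
Qed.

(** An induction on [(1 - d) * (1 + d *+ N.+1) <= 1 + d *+ N]; it makes the decay of powers
    explicit, so that the Archimedean property suffices to choose [N]. *)
Lemma bernoulli (d : R) N : 0 <= d <= 1 -> (1 - d) ^+ N * (1 + d *+ N) <= 1.
Proof.
move=> /andP[d0 d1]; elim: N => [|N IH]; first by rewrite expr0 mul1r mulr0n addr0.
apply: le_trans IH; rewrite exprSr -mulrA ler_wpM2l ?exprn_ge0 ?subr_ge0 //.
by rewrite mulrS; move: (d *+ N) (mulrn_wge0 N d0) => D D0; nra.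
Qed.

Lemma expr_small (beta eta : R) : 0 <= beta -> beta < 1 -> 0 < eta ->
  exists N, beta ^+ N <= eta.
Proof.
move=> b0 b1 e0; pose d := 1 - beta.
have d0 : 0 < d by rewrite subr_gt0.
have [N lN] : exists N, (d * eta)^-1 < N%:R.
  by exists (Num.bound (d * eta)^-1); apply: archi_boundP; rewrite invr_ge0 mulr_ge0 ?ltW.
exists N; have := @bernoulli d N; rewrite (_ : 1 - d = beta); last by rewrite /d subKr.
move=> /(_ _) B; have {}B : beta ^+ N * (1 + d *+ N) <= 1 by apply: B; rewrite ltW // /d; lra.
have big : eta^-1 <= 1 + d *+ N.
  apply: ltW; rewrite invfM in lN.
  have : eta^-1 < d *+ N by rewrite -mulr_natr mulrC -ltr_pdivrMr // mulrC.
  by move=> h; apply: lt_trans h _; rewrite ltrDr.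
have bN : 0 <= beta ^+ N by rewrite exprn_ge0.
have : beta ^+ N * eta^-1 <= 1 by apply: le_trans B; rewrite ler_wpM2l.
by rewrite ler_pdivrMr // mul1r.
Qed.

(** The interface between the two inclusions: all that amplification needs to know of the machine it
    repeats, stated with the expectation [ev] so that no random tape length is fixed. *)
Definition accepts_with (p0 : R) (M : TM) (k : nat) (L : language) : Prop :=
  forall x : seq bool, (1 < size x)%N ->
  let n := size x in
  let start := Defs.init M (k * up_log 2 n) (nseq (n ^ k) false) in
  let T := tbound k n in
  (forall r, tm_halt M (c_st (iter T (Defs.step M x r) start)) != None) /\
  p0 <= ev x T start (fun c => (tm_halt M (c_st c) == Some (L x))%:R).

Notation majority M k N x r :=
  (N < 2 * votes M x (k * up_log 2 (size x)) (nseq (size x ^ k) false)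
             (tbound k (size x)) N r)%N.

Lemma amplification (e eta : R) : 0 < e -> e <= 1 / 2 -> 0 < eta ->
  exists N, forall M k L, accepts_with (1 / 2 + e) M k L ->
  forall x m, (1 < size x)%N -> (N * tbound k (size x) <= m)%N ->
  1 - eta <= avg m (fun r => (majority M k N x r == L x)%:R).
Proof.
(* With this choice [alpha - alpha * beta] equals [e ^ 2 * (3 - 2 * e) / 2], which is positive;
   hence [beta < 1]. *)
move=> e0 e1 eta0; pose alpha : R := 1 - e.
have a0 : 0 < alpha by rewrite /alpha; lra.
have an0 : alpha != 0 by rewrite gt_eqF.
have a1 : alpha <= 1 by rewrite /alpha; lra.
have p0 : 0 <= 1 / 2 + e by lra.
pose beta := (1 / 2 + e) * alpha + (1 - (1 / 2 + e)) / alpha.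
have b0 : 0 <= beta.
  by rewrite addr_ge0 ?mulr_ge0 ?invr_ge0 ?(ltW a0) //; lra.
have b1 : beta < 1.
  rewrite -(ltr_pM2r a0) mul1r /beta mulrDl divfK // /alpha.
  have e2 : 0 < e * e by rewrite mulr_gt0.
  have : 0 < e * e * (3 - 2 * e) by rewrite mulr_gt0 //; lra.
  by lra.
have [N small] := expr_small b0 b1 eta0.
exists N => M k L acc x m n1 lm; have [halts good] := acc x n1.
have W := @votes_wrong M x _ _ _ N (L x) halts R _ alpha a0 a1 p0 good N m 0 0 lm (erefl _).
rewrite -/beta !expr0 divr1 mulr1 in W.
rewrite (eq_avg (g := fun r => -1 * (majority M k N x r != L x)%:R + 1)).
  rewrite avg_affine mulN1r [leRHS]addrC lerD2l lerN2; apply: le_trans small.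
  by apply: le_trans W; rewrite if_same.
by move=> r _; case: (_ == L x); rewrite /= ?mulr0 ?add0r // mulr1 addNr.
Qed.

Definition decision M k N b a x r : bool :=
  if bias_out b a r then majority M k N x (drop b r) else nth false r b.

Lemma decision_avg M k N b a x (v : bool) (eta : R) m : (a <= 2 ^ b)%N -> (b < m)%N ->
  1 - eta <= avg (m - b) (fun r => (majority M k N x r == v)%:R) ->
  forall q, q = a%:R / 2 ^+ b ->
  q * (1 - eta) + (1 - q) / 2 <= avg m (fun r => (decision M k N b a x r == v)%:R).
Proof.
move=> la lm maj q eq.
have q0 : 0 <= q by rewrite eq divr_ge0 ?ler0n ?exprn_ge0.
rewrite -{1}(subnKC (ltnW lm)).
rewrite (eq_avg (g := fun r => if bias_out b a r then (majority M k N x (drop b r) == v)%:R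
    else (nth false (drop b r) 0 == v)%:R)); last first.
  by move=> r _; rewrite /decision nth_drop addn0; case: ifP.
rewrite (avg_bias (m - b) (fun r => (majority M k N x r == v)%:R)
  (fun r => (nth false r 0 == v)%:R) la) -eq.
(* A fair coin is right half of the time for either value of [v]; [b < m] guarantees that a bit is
   left for it. *)
have -> : avg (m - b) (fun r => (nth false r 0 == v)%:R) = 1 / 2 :> R.
  rewrite -(subnSK lm) /= !avg_const; case: (v) => /=; lra.
by rewrite mul1r lerD2r ler_wpM2l.
Qed.

Lemma quiet_avg b a m : (a <= 2 ^ b)%N -> (b <= m)%N ->
  avg m (fun r => (~~ bias_out b a r)%:R) = 1 - a%:R / 2 ^+ b :> R.
Proof.
move=> la lm; rewrite -{1}(subnKC lm).
rewrite (eq_avg (g := fun r => if bias_out b a r then 0 else 1)); last first.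
  by move=> r _; case: ifP.
by rewrite (avg_bias (m - b) (fun=> 0) (fun=> 1) la) !avg_const mulr0 add0r mulr1.
Qed.

Lemma top_decides p0 M k N b a L x r t : accepts_with p0 M k L -> (1 < size x)%N ->
  (simulation_time k N b x (tbound k (size x)) < size t)%N ->
  exists2 s', runs (@t_mem _) (tsem x r) (top M k N b a L) (TState (f0 M N) 0 t 0 0)
      (simulation_time k N b x (tbound k (size x))) s' &
    out (t_mem s') = decision M k N b a x r /\ (~~ bias_out b a r -> t_tape s' = t).
Proof.
move=> acc n1 lt; rewrite /decision; case: ifP => [bT|/negbT bF].
  have [s' R1 o] := top_main L (acc x n1).1 n1 bT lt.
  by exists s'.
have [s' R1 [et o]] := top_random M k N L t n1 bF.
exists s' => //; apply: runs_weaken R1 _.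
by rewrite /simulation_time; lia.
Qed.

(** One exponent covers time, tape length and random bits. The 6 is the running time of [top_small],
    which the additive term of [tbound] must cover on inputs of length at most 1. *)
Lemma program_exponent k N b : exists k', (6 <= k')%N /\
  forall x : seq bool, (1 < size x)%N ->
    (simulation_time k N b x (tbound k (size x)) < size x ^ k')%N /\
    (b + (N * tbound k (size x)).+1 <= size x ^ k')%N.
Proof.
have [k1 b1] := poly_simulation_time k N b; have [k2 b2] := poly_random_bits k N b.
exists (maxn 6 (maxn k1 k2)); split=> [|x n1]; first exact: leq_maxl.
split; [apply: leq_trans (b1 x n1) _|apply: leq_trans (b2 _ n1) _].
  by rewrite leq_exp2l // !leq_max leqnn orbT.
by rewrite leq_exp2l // !leq_max leqnn !orbT.
Qed.

Lemma prob_true m : prob (fun _ : m.-tuple bool => true) = 1 :> R.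
Proof. by rewrite (prob_avg _ _ (fun=> true)) avg_const. Qed.

Lemma accepts_with_BPP p0 M k L : 1 / 2 < p0 -> p0 <= 1 -> accepts_with p0 M k L -> @BPP R L.
Proof.
move=> p_gt p_le acc.
have e0 : 0 < p0 - 1 / 2 by lra.
have e1 : p0 - 1 / 2 <= 1 / 2 by lra.
have eta0 : 0 < 1 / 3 :> R by lra.
have [N amp] := amplification e0 e1 eta0.
have [k' [k6 bounds]] := program_exponent k N 0.
(* With [b = 0] and [a = 1] the biased coin always succeeds, so [q = 1] and the vote is always
   taken, here on the work tape. *)
exists k', (compile true (top M k N 0 1 L) (f0 M N) (@out M N)) => x; set T := tbound k' _.
have T6 : (6 <= T)%N by rewrite /T /tbound; lia.
have [n1|n1] := leqP (size x) 1.
  have small (r : T.-tuple bool) : exists s', run (compile true (top M k N 0 1 L) (f0 M N)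
      (@out M N)) x T [::] r T = embed true (f0 M N) (@out M N) [::] None s' /\
      out (t_mem s') = L x.
    have [s' R1 [_ o]] := top_small M k N 0 1 L r (nseq T false) n1.
    by exists s'; split=> //; apply: run_compile_work; apply: runs_weaken R1 T6.
  split=> [r|]; first by have [s' [-> _]] := small r.
  rewrite (_ : prob _ = 1); first by lra.
  rewrite -(prob_true T); congr prob; apply/funext => r.
  by have [s' [-> /= ->]] := small r; rewrite eqxx.
have [time bits] := bounds x n1.
have lT : (size x ^ k' <= T)%N by rewrite leq_addr.
have large (r : T.-tuple bool) : exists s', run (compile true (top M k N 0 1 L) (f0 M N)
    (@out M N)) x T [::] r T = embed true (f0 M N) (@out M N) [::] None s' /\
    out (t_mem s') = decision M k N 0 1 x r.
  have [|s' R1 [o _]] := @top_decides p0 M k N 0 1 L x r (nseq T false) acc n1.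
    by rewrite size_nseq (leq_trans time).
  exists s'; split=> //; apply: run_compile_work; apply: runs_weaken R1 _.
  exact: leq_trans (ltnW time) lT.
split=> [r|]; first by have [s' [-> _]] := large r.
rewrite (_ : prob _ = prob (fun r : T.-tuple bool => decision M k N 0 1 x r == L x)); last first.
  by congr prob; apply/funext => r; have [s' [-> /= ->]] := large r.
rewrite (prob_avg _ _ (fun r => decision M k N 0 1 x r == L x)).
have acc' : accepts_with (1 / 2 + (p0 - 1 / 2)) M k L by rewrite addrC subrK.
have lb : (N * tbound k (size x) <= T - 0)%N by rewrite subn0; lia.
have := @decision_avg M k N 0 1 x (L x) (1 / 3) T isT (ltnW (ltnW (ltnW (ltnW (ltnW T6)))))
  (amp M k L acc' x _ n1 lb) 1.
by rewrite expr0 divr1 => /(_ erefl); apply: le_trans; lra.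
Qed.

End Acceptance.

Section Inclusions.
Variable R : realType.
Local Open Scope ring_scope.

(** The random tape of [2 ^ (n ^ k)] bits is never exhausted within the time bound. *)
Lemma tbound_le_exp k n : (1 < n)%N -> (tbound k n <= 2 ^ (n ^ k))%N.
Proof.
move=> n1; have kc : (k < n ^ k)%N by apply: ltn_expl.
rewrite /tbound; apply: (@leq_trans (2 * n ^ k)); first by lia.
case: (n ^ k)%N kc => // c _; rewrite expnS leq_mul2l /=.
exact: ltn_expl.
Qed.

Lemma BPCLP_accepts_with (delta eps : R) L : BPCLP delta eps L ->
  exists k M, accepts_with (1 / 2 + eps) M k L.
Proof.
move=> [k [M H]]; exists k, M => x n1 n start T.
(* Correctness is promised for every initial catalytic content; zeros are what blank tracks
   represent. *)
have [|halts [good _]] := H x (nseq (n ^ k) false); first by rewrite size_nseq.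
have lT : (T <= 2 ^ (n ^ k))%N := tbound_le_exp k n1.
split; first exact: (halts_any halts lT).
apply: le_trans good _.
rewrite (prob_avg _ _ (fun r => tm_halt M (c_st (run M x _ _ r _)) == Some (L x))).
by rewrite (@avg_run_start R M x _ _ _ _ (fun c => tm_halt M (c_st c) == Some (L x)) lT).
Qed.

Lemma BPP_accepts_with L : @BPP R L -> exists k M, accepts_with (2 / 3 : R) M k L.
Proof.
move=> [k [M H]].
(* The successor in [k.+1] makes [T < n ^ k1] strict, as [run_on_catalytic_tape] requires. *)
have [k1 bound] : poly_bounded (fun n => n ^ k + k.+1)%N.
  by apply: poly_add; [exact: poly_exp|exact: poly_const].
exists k1, (on_catalytic_tape M) => x n1 n start T1.
have [] := H x; set T := tbound k _ => halts good.
have lT : (T < n ^ k1)%N by rewrite -addnS; exact: bound.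
have lT1 : (T <= T1)%N by rewrite (leq_trans (ltnW lT)) // leq_addr.
have halts' := halts_any halts (leqnn T).
have same r : c_st (iter T1 (Defs.step (on_catalytic_tape M) x r) start) =
    c_st (run M x T [::] r T).
  have e := run_on_catalytic_tape M x (k1 * up_log 2 n) r lT.
  have h : tm_halt (on_catalytic_tape M)
      (c_st (iter T (Defs.step (on_catalytic_tape M) x r) start)) != None.
    by rewrite [c_st _]e; exact: halts'.
  by rewrite -e (iter_step_halt lT1 h).
split=> [r|]; first by rewrite same; exact: halts'.
rewrite -(@avg_run_start R (on_catalytic_tape M) x _ _ T1 T1
  (fun c => tm_halt (on_catalytic_tape M) (c_st c) == Some (L x)) (leqnn _)).
rewrite (eq_avg (g := fun r =>
  (tm_halt M (c_st (run M x T [::] r T)) == Some (L x))%:R)); last first.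
  by move=> r _; rewrite same.
(* Passing through [ev] changes the number of random bits from [T1] to [T]. *)
rewrite (@avg_run_start R M x _ _ T T1 (fun c => tm_halt M (c_st c) == Some (L x)) lT1).
rewrite -(@avg_run_start R M x _ _ T T (fun c => tm_halt M (c_st c) == Some (L x)) (leqnn _)).
apply: le_trans good _.
by rewrite (prob_avg _ _ (fun r => tm_halt M (c_st (run M x _ _ r _)) == Some (L x))).
Qed.

(** Finitely many fair coins only realise dyadic probabilities. *)
Lemma dyadic_between (u v : R) : 0 <= u -> u < v -> v <= 1 ->
  exists a b, [/\ (a <= 2 ^ b)%N, u < a%:R / 2 ^+ b & a%:R / 2 ^+ b <= v].
Proof.
move=> u0 uv v1; have d0 : 0 < v - u by rewrite subr_gt0.
have [b lb] : exists b, (v - u)^-1 < 2 ^+ b.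
  exists (Num.bound (v - u)^-1); apply: lt_trans (archi_boundP _) _.
    by rewrite invr_ge0 ltW.
  by rewrite -natrX ltr_nat ltn_expl.
have p0 : 0 < 2 ^+ b :> R by rewrite exprn_gt0.
have vp : 0 <= v * 2 ^+ b by rewrite mulr_ge0 ?(ltW p0) // (le_trans u0) // ltW.
(* The largest multiple of [2 ^- b] not above [v]; it exceeds [u] because the interval is longer
   than one grid step. *)
exists (Num.trunc (v * 2 ^+ b)), b; split.
- rewrite -(ler_nat R) natrX; apply: le_trans (_ : v * 2 ^+ b <= _).
    by rewrite truncn_le.
  by rewrite ler_piMl // ltW.
- rewrite ltr_pdivlMr //; have := truncnS_gt (v * 2 ^+ b); rewrite -natr1.
  have : 1 < (v - u) * 2 ^+ b by rewrite mulrC -ltr_pdivrMr ?div1r.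
  by rewrite mulrBl; set A := v * _; set B := u * _; move: A B => A B; lra.
- by rewrite ler_pdivrMr // truncn_le.
Qed.

Lemma accepts_with_BPCLP (delta eps p0 : R) M k L :
  delta < 1 -> 0 < eps -> 2 * eps < delta -> 1 / 2 < p0 -> p0 <= 1 ->
  accepts_with p0 M k L -> BPCLP delta eps L.
Proof.
move=> d1 eps0 lt_ed p_gt p_le acc.
have e0 : 0 < p0 - 1 / 2 by lra.
have e1 : p0 - 1 / 2 <= 1 / 2 by lra.
have u0 : 0 <= 2 * eps by lra.
have [a [b [la]]] := dyadic_between u0 lt_ed (ltW d1).
set q := _ / _ => q_gt q_le.
(* The success probability is [1 / 2 + q / 2 - q * eta], so [q * eta <= (q - 2 * eps) / 2] is
   wanted; as [q <= 1], this [eta] will do. *)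
have eta0 : 0 < (q - 2 * eps) / 2 by lra.
have [N amp] := amplification e0 e1 eta0.
have [k' [k6 bounds]] := program_exponent k N b.
pose M' := compile false (top M k N b a L) (f0 M N) (@out M N).
exists k', M' => x tau n s c T sz.
have T6 : (6 <= T)%N := leq_trans k6 (leq_addl _ _).
pose m := (2 ^ c)%N.
have [n1|n1] := leqP n 1.
  have small (r : m.-tuple bool) : exists s', [/\ run M' x s tau r T =
      embed false (f0 M N) (@out M N) (nseq s false) None s',
      t_tape s' = tau & out (t_mem s') = L x].
    have [s' R1 [et o]] := top_small M k N b a L r tau n1.
    by exists s'; split=> //; apply: run_compile_cat; apply: runs_weaken R1 T6.
  split=> [r|]; first by have [s' [-> _ _]] := small r.
  split.
    rewrite (_ : prob _ = 1); first by lra.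
    rewrite -(prob_true R m); congr prob; apply/funext => r.
    by have [s' [-> _ /= ->]] := small r; rewrite eqxx.
  rewrite (_ : prob _ = 1); first by lra.
  rewrite -(prob_true R m); congr prob; apply/funext => r.
  by have [s' [-> /= -> _]] := small r; rewrite eqxx.
have [time bits] := bounds x n1.
have lT : (n ^ k' <= T)%N by rewrite leq_addr.
have large (r : m.-tuple bool) : exists s', [/\ run M' x s tau r T =
    embed false (f0 M N) (@out M N) (nseq s false) None s',
    out (t_mem s') = decision M k N b a x r & ~~ bias_out b a r -> t_tape s' = tau].
  have [|s' R1 [o et]] := @top_decides R p0 M k N b a L x r tau acc n1; first by rewrite sz.
  exists s'; split=> //; apply: run_compile_cat; apply: runs_weaken R1 _.
  exact: leq_trans (ltnW time) lT.
(* The random tape is exponentially longer than the catalytic tape, whose length already bounds the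
   bits consumed. *)
have lm : (b + (N * tbound k n).+1 <= m)%N.
  by apply: leq_trans bits _; apply/ltnW/ltn_expl.
have lbm : (b < m)%N by apply: leq_trans lm; rewrite addnS ltnS leq_addr.
split=> [r|]; first by have [s' [-> _ _]] := large r.
split.
  rewrite (_ : prob _ = prob (fun r : m.-tuple bool => decision M k N b a x r == L x)); last first.
    by congr prob; apply/funext => r; have [s' [-> /= -> _]] := large r.
  rewrite (prob_avg _ _ (fun r => decision M k N b a x r == L x)).
  have acc' : accepts_with (1 / 2 + (p0 - 1 / 2)) M k L by rewrite addrC subrK.
  have lb : (N * tbound k n <= m - b)%N.
    by rewrite leq_subRL ?(ltnW lbm) // (leq_trans _ lm) // leq_add2l leqnSn.
  have := decision_avg la lbm (amp M k L acc' x _ n1 lb).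
  move=> /(_ q erefl); apply: le_trans.
  have : q <= 1 by lra.
  have : 0 < (q - 2 * eps) by lra.
  by nra.
apply: (@le_trans _ _ (prob (fun r : m.-tuple bool => ~~ bias_out b a r))).
  rewrite (prob_avg _ _ (fun r => ~~ bias_out b a r)) quiet_avg // ?(ltnW lbm) //.
  by rewrite lerD2l lerN2.
(* On every random string for which the biased coin fails, the tape is restored, so it suffices to
   compare the two sets of strings. *)
rewrite /prob ler_pM2r ?invr_gt0 ?ltr0n ?expn_gt0 // ler_nat.
apply/subset_leq_card/subsetP => r; rewrite !inE => quiet.
by have [s' [-> _ /= et]] := large r; rewrite et.
Qed.

End Inclusions.

Local Open Scope ring_scope.

Theorem theorem4p3 (R : realType) (delta eps : R) :
  0 <= delta -> delta < 1 -> 0 < eps -> eps <= 1 / 2 -> 2 * eps < delta ->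
  forall L : language, BPCLP delta eps L <-> @BPP R L.
Proof.
move=> _ d1 e0 e1 ed L; split.
  move=> /BPCLP_accepts_with [k [M acc]].
  by apply: accepts_with_BPP acc; lra.
move=> /BPP_accepts_with [k [M acc]].
by apply: accepts_with_BPCLP acc => //; lra.
Qed.
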